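(* Let $\mathbb{LC}^2=\{(t\cos\varphi,\,t\sin\varphi,\,\tfrac1t\cos\varphi,\,\tfrac1t\sin\varphi)\in\mathbb{R}^4=\mathbb{C}^2 : t>0,\ 0\le\varphi<2\pi\}$ be the Lagrangian catenoid, and let $\mathbb{B}^4$ be the (closed) unit ball in $\mathbb{R}^4$. For any $r_0>\sqrt2$, the set $\left(\tfrac{1}{r_0}\mathbb{LC}^2\right)\cap\mathbb{B}^4$ is a Lagrangian, minimal annulus with a Legendrian capillary boundary. Moreover, the two components of its boundary are great circles.
   Context: Coordinates on $\mathbb{R}^4=\mathbb{C}^2$ are $(x_1,x_2,y_1,y_2)$, with the standard Euclidean metric $\langle\cdot,\cdot\rangle$, the complex structure $J(x_1,x_2,y_1,y_2)=(-y_1,-y_2,x_1,x_2)$ and the symplectic form $\omega_0=\sum_{i=1}^2dx_i\wedge dy_i$. A surface $\Sigma$ is Lagrangian if $\omega_0$ restricts to $0$ on $\Sigma$ (equivalently $J(T\Sigma)=N\Sigma$, the normal bundle), and minimal if its mean curvature vector vanishes. Let $N$ be the outward unit normal of $\mathbb{S}^3=\partial\mathbb{B}^4$ (so $N$ at $x\in\mathbb{S}^3$ is $x$). For $\Sigma\subset\mathbb{B}^4$ Lagrangian with $\partial\Sigma\subset\mathbb{S}^3$, the boundary is Legendrian if $JN\perp T\partial\Sigma$ everywhere on $\partial\Sigma$. In that case the outward unit conormal $\mu$ of $\partial\Sigma$ in $\Sigma$ lies in $\mathrm{span}\{N,JN\}$, and the contact angle is the angle function $\theta\in[0,\pi)$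 on $\partial\Sigma$ with $\mu=\sin\theta\,N+\cos\theta\,JN$. A Lagrangian surface in $\mathbb{B}^4$ with Legendrian boundary on $\mathbb{S}^3$ is said to have Legendrian capillary boundary if its contact angle is a constant.
   Formalization: The contact angle is shown to be constant on each boundary component, not on the whole boundary: with the outward conormal, its cosine is −2/r0² on one circle and +2/r0² on the other, so a single constant angle fails for every r0 > √2. *)

(* Defs.v *)
From mathcomp Require Import all_boot all_order all_algebra.
From mathcomp Require Import all_classical all_reals all_analysis.

Set Implicit Arguments.
Unset Strict Implicit.
Unset Printing Implicit Defensive.

Import Order.TTheory GRing.Theory Num.Theory.
Import numFieldNormedType.Exports.

Local Open Scope classical_set_scope.
Local Open Scope ring_scope.

Section EuclideanSpace.
Variable R : realType.

(* The library norm on 'rV[R]_n is the sup norm: it is used below only through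
   the topology and the differential calculus.  Euclidean lengths and angles
   are those of dotv. *)
Definition dotv n (u v : 'rV[R]_n) : R := \sum_(i < n) u 0 i * v 0 i.

Definition enorm n (u : 'rV[R]_n) : R := Num.sqrt (dotv u u).

Definition vec4 (a b c d : R) : 'rV[R]_4 := \row_(j < 4) [:: a; b; c; d]`_j.

Definition x1 (v : 'rV[R]_4) : R := v 0 0.
Definition x2 (v : 'rV[R]_4) : R := v 0 1.
Definition y1 (v : 'rV[R]_4) : R := v 0 2.
Definition y2 (v : 'rV[R]_4) : R := v 0 3.

Definition Jc (v : 'rV[R]_4) : 'rV[R]_4 :=
  vec4 (- y1 v) (- y2 v) (x1 v) (x2 v).

Definition omega0 (v w : 'rV[R]_4) : R :=
  (x1 v * y1 w - y1 v * x1 w) + (x2 v * y2 w - y2 v * x2 w).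

Definition B4 : set 'rV[R]_4 := [set x | enorm x <= 1].
Definition S3 : set 'rV[R]_4 := [set x | enorm x = 1].

Definition great_circle (C : set 'rV[R]_4) : Prop :=
  exists W : 'M[R]_(2, 4), \rank W = 2%N /\ C = S3 `&` [set x | (x <= W)%MS].

End EuclideanSpace.

Section Calculus.
Variable R : realType.

(* On an open set, C^(n+1) amounts to: differentiable, with all directional
   derivatives of class C^n. *)
Fixpoint Ck_on (n : nat) (V W : normedModType R) (U : set V) (f : V -> W)
    : Prop :=
  match n with
  | 0 => forall u, U u -> {for u, continuous f}
  | n'.+1 => (forall u, U u -> differentiable f u) /\
             (forall v, Ck_on n' U (fun u => 'D_v f u))
  end.

Definition smooth_on (V W : normedModType R) (U : set V) (f : V -> W) : Prop :=
  forall n, Ck_on n U f.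

Definition immersion_on (V W : normedModType R) (U : set V) (f : V -> W)
    : Prop :=
  forall u, U u -> injective ('d f u : V -> W).

Definition partial n (W : normedModType R) (i : 'I_n.+1)
    (f : 'rV[R]_n.+1 -> W) : 'rV[R]_n.+1 -> W :=
  fun u => 'D_(delta_mx 0 i) f u.

End Calculus.

Section Surfaces.
Variable R : realType.
Implicit Types (S : set 'rV[R]_4) (X : 'rV[R]_2 -> 'rV[R]_4).
Implicit Types (U : set 'rV[R]_2) (p v w mu : 'rV[R]_4).

Definition half_plane : set 'rV[R]_2 := [set u | 0 <= u 0 0].

(* A local parametrization of S modelled on the half plane: X is a smooth
   immersion on the open set U, and restricts to a homeomorphism (with inverse
   Y) from U `&` half_plane onto a relatively open subset of S.  Charts around
   interior points are those around points u with 0 < u 0 0. *)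
Definition chart S X U : Prop :=
  [/\ open U, smooth_on U X, immersion_on U X,
      exists2 V : set 'rV[R]_4, open V & X @` (U `&` half_plane) = S `&` V
    & exists2 Y : 'rV[R]_4 -> 'rV[R]_2,
        {within X @` (U `&` half_plane), continuous Y} &
        forall u, (U `&` half_plane) u -> Y (X u) = u].

Definition chart_at S X U (u : 'rV[R]_2) p : Prop :=
  [/\ chart S X U, U u, half_plane u & X u = p].

Definition embedded_surface S : Prop :=
  forall p, S p -> exists X U (u : 'rV[R]_2), chart_at S X U u p.

Definition bdry S : set 'rV[R]_4 :=
  [set p | exists X U (u : 'rV[R]_2), chart_at S X U u p /\ u 0 0 = 0].

Definition tangent S p : set 'rV[R]_4 :=
  [set v | exists X U u (h : 'rV[R]_2), chart_at S X U u p /\ v = 'd X u h].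

Definition bdry_tangent S p : set 'rV[R]_4 :=
  [set v | exists X U u (h : 'rV[R]_2),
     [/\ chart_at S X U u p, u 0 0 = 0, h 0 0 = 0 & v = 'd X u h]].

(* mu points out of S because h points out of the half plane. *)
Definition outward_conormal S p mu : Prop :=
  [/\ exists X U u (h : 'rV[R]_2),
        [/\ chart_at S X U u p, u 0 0 = 0, h 0 0 < 0 & mu = 'd X u h],
      enorm mu = 1
    & forall v, bdry_tangent S p v -> dotv mu v = 0].

Definition lagrangian S : Prop :=
  forall p v w, S p -> tangent S p v -> tangent S p w -> omega0 v w = 0.

Definition gram X (u : 'rV[R]_2) : 'M[R]_2 :=
  \matrix_(i, j) dotv (partial i X u) (partial j X u).

Definition normal_part X (u : 'rV[R]_2) v : 'rV[R]_4 :=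
  v - \sum_i \sum_j
        (invmx (gram X u) i j * dotv v (partial i X u)) *: partial j X u.

(* The trace g^{ij} (d_i d_j X)^perp of the second fundamental form. *)
Definition mean_curvature X (u : 'rV[R]_2) : 'rV[R]_4 :=
  \sum_i \sum_j
    invmx (gram X u) i j *: normal_part X u (partial i (partial j X) u).

Definition minimal S : Prop :=
  forall X U u p, chart_at S X U u p -> mean_curvature X u = 0.

(* S is diffeomorphic to a closed planar annulus; f is an embedding since the
   annulus is compact. *)
Definition annulus S : Prop :=
  exists (a b : R) (U : set 'rV[R]_2) (f : 'rV[R]_2 -> 'rV[R]_4),
    let A := [set z : 'rV[R]_2 | a <= enorm z <= b] in
    [/\ 0 < a < b, open U /\ A `<=` U, smooth_on U f /\ immersion_on U f,
        set_inj A f & f @` A = S].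

(* The outward unit normal N of S3 at p is p itself. *)
Definition legendrian_boundary S : Prop :=
  [/\ S `<=` @B4 R, bdry S `<=` @S3 R &
      forall p v, bdry S p -> bdry_tangent S p v -> dotv (Jc p) v = 0].

Definition contact_angle S p (theta : R) : Prop :=
  0 <= theta < pi /\
  exists2 mu, outward_conormal S p mu &
    mu = sin theta *: p + cos theta *: Jc p.

(* The contact angle is a constant on each connected component of the
   boundary.  (On the two boundary circles of the truncated catenoid the angles
   are supplementary and distinct.) *)
Definition legendrian_capillary_boundary S : Prop :=
  legendrian_boundary S /\
  exists theta : 'rV[R]_4 -> R,
    (forall p, bdry S p -> contact_angle S p (theta p)) /\
    (forall p q, bdry S p -> connected_component (bdry S) p q ->
       theta q = theta p).

Definition components (A : set 'rV[R]_4) : set (set 'rV[R]_4) :=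
  [set connected_component A p | p in A].

Definition lagrangian_catenoid : set 'rV[R]_4 :=
  [set p | exists t phi : R, [/\ 0 < t, 0 <= phi < 2 * pi &
     p = vec4 (t * cos phi) (t * sin phi)
              (t^-1 * cos phi) (t^-1 * sin phi)]].

Definition truncated_catenoid (r0 : R) : set 'rV[R]_4 :=
  [set r0^-1 *: p | p in lagrangian_catenoid] `&` @B4 R.

End Surfaces.

(* Main.v *)
Require Import Defs.
From HB Require Import structures.
From mathcomp Require Import all_boot all_order all_algebra.
From mathcomp Require Import all_classical all_reals all_analysis.
From mathcomp Require Import ring lra.
Import Order.TTheory GRing.Theory Num.Theory.
Import numFieldNormedType.Exports.
Local Open Scope classical_set_scope.
Local Open Scope ring_scope.

(** Regroup the coordinates as x = x1 + i x2 and y = y1 + i y2, and write a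
    tangent vector as (xi, eta) in the same way.  The rescaled catenoid is then
    the curve x * conj y = c with c = r0^-2, so that the truncated catenoid is
    the part of the quadric { Re (x conj y) = c, Im (x conj y) = 0 } that lies in
    the unit ball (truncated_catenoidE).  The whole proof works with these two
    quadratic equations, whose polar forms are reB and imB.

    The function x * conj y is holomorphic for the orthogonal complex structure
    K (x, y) = (i x, - i y).  Its level set is a complex curve for K: the tangent
    planes are the complex lines { conj eta = m xi } (quadric_tangent_slope).
    Such a line is Lagrangian for omega0, because xi conj eta' - xi' conj eta
    vanishes on it.  The curve is minimal because differentiating the equations
    twice expresses the second fundamental form through their Hessians, and the
    real and imaginary parts of a complex quadratic form are trace free on every
    complex line (quadric_trace_free).

    The definitions quantify over all charts of the surface, so an arbitrary
    chart X has to be controlled.  Since X maps U `&` half_plane into the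
    quadric, the equations hold along X on a half plane, and one-sided
    derivatives at the edge determine the differential: this gives tangency and
    the second order relations up to the boundary (derive_cst_half_plane,
    chart_tangent, chart_second).  That an edge point of a chart lies on the
    sphere (bdry_quadric_sphere) is invariance of the boundary; as the
    differential of the chart is injective, first order approximation at one
    point is enough: move from an interior point in the direction that leaves
    the half plane, lift to the chart, and get a negative first coordinate.

    On the curve |y| = c / |x|, so it meets the ball where
    |x|^2 + c^2 / |x|^2 <= 1, that is a <= |x| <= b where a b = c and
    a^2 + b^2 = 1; the radii exist and are distinct because r0 > sqrt 2
    (radii_exist).  The surface is thus the graph of x |-> c x / |x|^2 over an
    annulus (annulus_quadric), and the rational charts polar_chart, based on the
    stereographic parameter of the circle and on the distance to one of the two
    boundary circles, show that it is an embedded surface with boundary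
    { |x| = a } and { |x| = b } (bdryE).

    On either circle y is a constant multiple of x, so each of them is the
    intersection of the sphere with a plane (bdry_circle_great).  Their tangent
    lines are spanned by (i x, i y) (quadric_sphere_tangent), which is orthogonal
    to Jc p; the conormal is (x, - y) on { |x| = b } and (- x, y) on { |x| = a },
    and comparing it with p and Jc p gives a contact angle with cosine - 2 c on
    the first circle and 2 c on the second (contact_angle_quadric). *)

(** * Functions of class C^n *)

(** The differential of f serves as the differential of g, since the remainder
    terms agree near x. *)
Lemma near_eq_differentiable {R : realType} {V W : normedModType R}
    (f g : V -> W) x :
  {near x, f =1 g} -> differentiable f x -> differentiable g x.
Proof.
move=> fg df; have [cdf dfE] := (diff_locallyP _ _).1 df.
have fg0 : \forall h \near (0 : V), f (h + x) = g (h + x).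
  by have := fg; rewrite (near_shift 0) /= subr0.
have gE : g \o shift x = cst (g x) + 'd f x +o_ 0 id.
  apply/eqaddoP => _/posnumP[e].
  have /eqaddoP/(_ _ (gt0 e)) := dfE.
  apply: filter_app; near=> h => /=.
  rewrite -[(_ - _) h]/(f (h + x) - (f x + 'd f x h)).
  rewrite -[(_ - _ : V -> W) h]/(g (h + x) - (g x + 'd f x h)).
  rewrite (nbhs_singleton fg).
  by suff -> : f (h + x) = g (h + x) by []; near: h.
have dgE : 'd g x = 'd f x :> (V -> W) by exact: diff_unique.
by apply/diff_locallyP; rewrite dgE.
Unshelve. all: by end_near. Qed.

Section CkTheory.
Context {R : realType} {V : normedModType R} {U : set V}.
Hypothesis oU : open U.

Lemma near_eq_on (W : Type) (f g : V -> W) u :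
  {in U, f =1 g} -> U u -> {near u, f =1 g}.
Proof.
by move=> fg Uu; near=> x; apply/fg/mem_set; near: x; exact: open_nbhs_nbhs.
Unshelve. all: by end_near. Qed.

(** Openness of U makes directional derivatives at points of U insensitive to
    the values outside U; this is what lets the derivative of a product or of an
    inverse be replaced by its usual expression, valid on U only. *)
Lemma Ck_on_ext (W : normedModType R) n (f g : V -> W) :
  {in U, f =1 g} -> Ck_on n U f -> Ck_on n U g.
Proof.
elim: n f g => [|n IH] f g fg /=.
  move=> cf u Uu; have := cf u Uu.
  move=> cfu; rewrite /prop_for /continuous_at -(fg u (mem_set Uu)).
  by apply: cvg_trans cfu; apply: near_eq_cvg; exact: near_eq_on.
move=> [df Df]; split=> [u Uu|v].
  exact: near_eq_differentiable (near_eq_on _ _ _ _ fg Uu) (df u Uu).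
apply: (IH ('D_v f)) => [u /set_mem Uu|]; last exact: Df.
exact/near_eq_derive/near_eq_on.
Qed.

Lemma Ck_on_continuous (W : normedModType R) n (f : V -> W) :
  Ck_on n U f -> forall u, U u -> {for u, continuous f}.
Proof.
by case: n => [//|n [df _] u Uu]; exact/differentiable_continuous/df.
Qed.

Lemma Ck_on_pred (W : normedModType R) n (f : V -> W) :
  Ck_on n.+1 U f -> Ck_on n U f.
Proof.
elim: n f => [|n IH] f; first exact: Ck_on_continuous.
by move=> [df Df]; split=> // v; apply: IH; exact: Df.
Qed.

Lemma Ck_on_cst (W : normedModType R) n (w : W) : Ck_on n U (cst w).
Proof.
elim: n w => [|n IH] w /=; first by move=> u _; exact: (@cst_continuous _ _ w).
split=> [u _|v]; first exact: differentiable_cst.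
by apply: (Ck_on_ext _ _ (cst 0)) => // u _; rewrite derive_cst.
Qed.

Lemma Ck_on_add (W : normedModType R) n (f g : V -> W) :
  Ck_on n U f -> Ck_on n U g -> Ck_on n U (fun u => f u + g u).
Proof.
elim: n f g => [|n IH] f g.
  by move=> cf cg u Uu; apply: continuousD; [exact: cf|exact: cg].
move=> [df Df] [dg Dg]; split=> [u Uu|v].
  by apply: differentiableD; [exact: df|exact: dg].
apply: (Ck_on_ext _ _ (fun u => 'D_v f u + 'D_v g u)); last exact: IH (Df v) (Dg v).
move=> u /set_mem Uu.
by rewrite -(deriveD (@diff_derivable _ _ _ _ _ v (df u Uu)) (@diff_derivable _ _ _
  _ _ v (dg u Uu))).
Qed.

Lemma Ck_on_mul n (f g : V -> R) :
  Ck_on n U f -> Ck_on n U g -> Ck_on n U (fun u => f u * g u).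
Proof.
elim: n f g => [|n IH] f g.
  by move=> cf cg u Uu; apply: (@continuousM R); [exact: cf|exact: cg].
move=> Cf Cg; have [[df Df] [dg Dg]] := (Cf, Cg); split=> [u Uu|v].
  by apply: differentiableM; [exact: df|exact: dg].
apply: (Ck_on_ext _ _ (fun u => f u * 'D_v g u + g u * 'D_v f u)); last first.
  apply: Ck_on_add; apply: IH.
  - exact: Ck_on_pred.
  - exact: Dg.
  - exact: Ck_on_pred.
  - exact: Df.
move=> u /set_mem Uu.
by rewrite -(deriveM (@diff_derivable _ _ _ _ _ v (df u Uu)) (@diff_derivable _ _ _
  _ _ v (dg u Uu))).
Qed.

(** Induction on n: the derivative of 1/f is - f' / f^2, which is of class C^n
    as soon as 1/f is. *)
Lemma Ck_on_inv n (f : V -> R) : (forall u, U u -> f u != 0) ->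
  Ck_on n U f -> Ck_on n U (fun u => (f u)^-1).
Proof.
move=> f0; elim: n => [|n IH].
  by move=> cf u Uu; apply: continuousV; [exact: f0|exact: cf].
move=> Cf; have [df Df] := Cf; split=> [u Uu|v].
  by apply: differentiableV; [exact: df|exact: f0].
have Ci : Ck_on n U (fun u => (f u)^-1) by apply: IH; exact: Ck_on_pred.
apply: (Ck_on_ext _ _ (fun u => (-1) * (((f u)^-1 * (f u)^-1) * 'D_v f u)));
  last first.
  apply: Ck_on_mul; first exact: Ck_on_cst.
  apply: Ck_on_mul; [exact: Ck_on_mul|exact: Df].
move=> u /set_mem Uu; rewrite deriveV; [|exact: f0|exact/diff_derivable/df].
by rewrite mulN1r -scaleNr -invfM -expr2.
Qed.

Lemma Ck_on_scalel (W : normedModType R) n (f : V -> R) (w : W) :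
  Ck_on n U f -> Ck_on n U (fun u => f u *: w).
Proof.
elim: n f => [|n IH] f.
  by move=> cf u Uu; apply: continuousZr_tmp; exact: cf.
move=> [df Df]; split=> [u Uu|v]; first by apply: differentiableZl; exact: df.
apply: (Ck_on_ext _ _ (fun u => 'D_v f u *: w)); last exact: IH (Df v).
move=> u /set_mem Uu; have dfu := df u Uu.
by rewrite !deriveE ?diffZl//; exact: differentiableZl.
Qed.

Lemma Ck_on_sum (W : normedModType R) m n (F : 'I_m -> V -> W) :
  (forall j, Ck_on n U (F j)) -> Ck_on n U (fun u => \sum_j F j u).
Proof.
elim: m F => [|m IH] F CF.
  by apply: (Ck_on_ext _ _ (cst 0)) (Ck_on_cst _ _ 0) => u _; rewrite big_ord0.
apply: (Ck_on_ext _ _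
    (fun u => \sum_(j < m) F (widen_ord (leqnSn m) j) u + F ord_max u)).
  by move=> u _; rewrite big_ord_recr.
by apply: Ck_on_add => //; apply: IH.
Qed.

Lemma Ck_on_row m n (f : 'I_m -> V -> R) :
  (forall j, Ck_on n U (f j)) -> Ck_on n U (fun u => \row_j f j u).
Proof.
move=> Cf; apply: (Ck_on_ext _ _ (fun u => \sum_j f j u *: delta_mx 0 j)).
  by move=> u _; rewrite [RHS]row_sum_delta; apply: eq_bigr => j _; rewrite mxE.
by apply: (Ck_on_sum _ _ _ (fun j u => f j u *: delta_mx 0 j)) => j;
  exact: Ck_on_scalel.
Qed.

Lemma Ck_on_vec4 n (f0 f1 f2 f3 : V -> R) :
  Ck_on n U f0 -> Ck_on n U f1 -> Ck_on n U f2 -> Ck_on n U f3 ->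
  Ck_on n U (fun u => vec4 (f0 u) (f1 u) (f2 u) (f3 u)).
Proof.
move=> C0 C1 C2 C3.
by apply: (Ck_on_row 4 n (fun j u => [:: f0 u; f1 u; f2 u; f3 u]`_j))
  => -[[|[|[|[|//]]]] j].
Qed.

End CkTheory.

Lemma derive_coord {R : realType} {V : normedModType R} {m n : nat}
    (f : V -> 'M[R]_(m, n)) t v i j :
  derivable f t v -> is_derive t v (fun x => f x i j) ('D_v f t i j).
Proof.
move=> df; apply: DeriveDef; first exact: ((derivable_mxP _ _ _).1 df).
by rewrite derive_mx// mxE.
Qed.

Lemma is_derive_coord {R : realType} {m n : nat} (t v : 'M[R]_(m, n)) i j :
  is_derive t v (fun x => x i j) (v i j).
Proof.
by have := derive_coord id t v i j (@derivable_id _ _ _ _); rewrite derive_id.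
Qed.

Lemma Ck_on_coord {R : realType} (m n : nat) (U : set 'M[R]_(m, n)) k i j :
  open U -> Ck_on k U (fun u => u i j : R).
Proof.
move=> oU; case: k => [|k] /=; first by move=> u _; exact: coord_continuous.
split=> [u _|v]; first exact: differentiable_coord.
apply: (Ck_on_ext oU _ _ (cst (v i j))); last exact: Ck_on_cst.
by move=> u _; have dc := is_derive_coord u v i j; rewrite derive_val.
Qed.

(** * Functions that are constant along a half plane *)

Section Rays.
Context {R : realType} {V : normedModType R}.

(** A two-sided derivative is also the limit of the difference quotients from
    the right. *)
Lemma derive_cst_ray (f : V -> R) u h c :
  derivable f u h -> f u = c ->
  (\forall t \near 0^'+, f (t *: h + u) = c) -> 'D_h f u = 0.
Proof.
move=> df fu fc.
have cv : (fun t => t^-1 *: ((f \o shift u) (t *: h) - f u)) @ 0^'+ --> 'D_h f u.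
  exact: (cvg_dnbhs_at_right df).
rewrite -(cvg_lim (@norm_hausdorff _ _) cv); apply: lim_near_cst => //; near=> t.
have -> : (f \o shift u) (t *: h) = c by near: t.
by rewrite fu subrr scaler0.
Unshelve. all: by end_near. Qed.

Lemma near_ray (P : set V) u h :
  (\forall z \near u, P z) -> \forall t \near (0 : R), P (t *: h + u).
Proof.
move=> Pu; apply: (@near0Z _ _ h [set z | P (z + u)]).
by move: Pu; rewrite (near_shift 0) /= subr0.
Qed.

End Rays.

Section HalfPlane.
Context {R : realType}.

(** At an edge point only the directions with nonnegative first coordinate stay
    in the half plane; the others are their opposites, and the differential is
    linear. *)
Lemma derive_cst_half_plane (U : set 'rV[R]_2) (f : 'rV[R]_2 -> R) u c :
  open U -> U u -> half_plane u -> differentiable f u ->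
  (forall z, U z -> half_plane z -> f z = c) -> forall h, 'D_h f u = 0.
Proof.
move=> oU Uu Hu df fc.
have pos (h : 'rV[R]_2) : 0 <= h 0 0 -> 'D_h f u = 0.
  move=> h0; apply: (derive_cst_ray f u h c); [exact: diff_derivable|exact: fc|].
  near=> t; apply: fc.
    by near: t; apply: cvg_within; exact/near_ray/open_nbhs_nbhs.
  rewrite /half_plane /= !mxE; apply: addr_ge0; last exact: Hu.
  by apply: mulr_ge0; [near: t; exact: nbhs_right_ge|exact: h0].
move=> h; have [/pos//|hlt0] := leP 0 (h 0 0).
rewrite deriveE// -[h]opprK linearN /= -deriveE// pos ?oppr0//.
by rewrite mxE oppr_ge0 ltW.
Unshelve. all: by end_near. Qed.

Lemma derive_cst_line (U : set 'rV[R]_2) (f : 'rV[R]_2 -> R) u c :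
  open U -> U u -> u 0 0 = 0 -> differentiable f u ->
  (forall z, U z -> z 0 0 = 0 -> f z = c) ->
  forall h : 'rV[R]_2, h 0 0 = 0 -> 'D_h f u = 0.
Proof.
move=> oU Uu u0 df fc h h0; apply: (derive_cst_ray f u h c).
- exact: diff_derivable.
- exact: fc.
near=> t; apply: fc.
  by near: t; apply: cvg_within; exact/near_ray/open_nbhs_nbhs.
by rewrite !mxE h0 u0 mulr0 addr0.
Unshelve. all: by end_near. Qed.

End HalfPlane.

(** * The quadratic equations of the catenoid *)

Section Forms.
Context {R : realType}.
Implicit Types p q v w : 'rV[R]_4.

(** Polar forms of 2 Re (x conj y) and 2 Im (x conj y): the complex number
    reB p v + i imB p v is x conj eta + xi conj y. *)
Definition reB p v : R :=
  x1 p * y1 v + y1 p * x1 v + (x2 p * y2 v + y2 p * x2 v).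
Definition imB p v : R :=
  x2 p * y1 v + y1 p * x2 v - (x1 p * y2 v + y2 p * x1 v).

Lemma vec4E (a b c d : R) : [/\ x1 (vec4 a b c d) = a, x2 (vec4 a b c d) = b,
  y1 (vec4 a b c d) = c & y2 (vec4 a b c d) = d].
Proof. by rewrite /x1 /x2 /y1 /y2 !mxE. Qed.

Lemma eq_vec4 p q : x1 p = x1 q -> x2 p = x2 q -> y1 p = y1 q -> y2 p = y2 q ->
  p = q.
Proof.
move=> h1 h2 h3 h4; apply/rowP => -[[|[|[|[|//]]]] i].
- by move: h1; rewrite /x1; congr (p _ _ = q _ _); exact: val_inj.
- by move: h2; rewrite /x2; congr (p _ _ = q _ _); exact: val_inj.
- by move: h3; rewrite /y1; congr (p _ _ = q _ _); exact: val_inj.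
- by move: h4; rewrite /y2; congr (p _ _ = q _ _); exact: val_inj.
Qed.

Lemma dotv4E p q : dotv p q = x1 p * x1 q + x2 p * x2 q + y1 p * y1 q + y2 p * y2 q.
Proof.
rewrite /dotv !big_ord_recr big_ord0 /= add0r /x1 /x2 /y1 /y2.
by repeat (congr (_ + _)); congr (p _ _ * q _ _); exact: val_inj.
Qed.

Lemma coord_lin a p q : [/\ x1 (a *: p + q) = a * x1 p + x1 q,
 x2 (a *: p + q) = a * x2 p + x2 q, y1 (a *: p + q) = a * y1 p + y1 q &
 y2 (a *: p + q) = a * y2 p + y2 q].
Proof. by rewrite /x1 /x2 /y1 /y2 !mxE. Qed.

Lemma reB_is_scalar p : scalar (reB p).
Proof.
move=> a v w; have [h1 h2 h3 h4] := coord_lin a v w.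
by rewrite /reB h1 h2 h3 h4 /GRing.scale /=; ring.
Qed.
HB.instance Definition _ p :=
  GRing.isLinear.Build R 'rV[R]_4 R *%R (reB p) (reB_is_scalar p).

Lemma imB_is_scalar p : scalar (imB p).
Proof.
move=> a v w; have [h1 h2 h3 h4] := coord_lin a v w.
by rewrite /imB h1 h2 h3 h4 /GRing.scale /=; ring.
Qed.
HB.instance Definition _ p :=
  GRing.isLinear.Build R 'rV[R]_4 R *%R (imB p) (imB_is_scalar p).

Lemma dotv_is_scalar p : scalar (dotv p).
Proof.
move=> a v w; have [h1 h2 h3 h4] := coord_lin a v w.
by rewrite !dotv4E h1 h2 h3 h4 /GRing.scale /=; ring.
Qed.
HB.instance Definition _ p :=
  GRing.isLinear.Build R 'rV[R]_4 R *%R (dotv p) (dotv_is_scalar p).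

Lemma dotvC p q : dotv p q = dotv q p.
Proof. by rewrite !dotv4E; ring. Qed.

Lemma reBC (p q : 'rV[R]_4) : reB p q = reB q p.
Proof. by rewrite /reB; ring. Qed.

Lemma imBC (p q : 'rV[R]_4) : imB p q = imB q p.
Proof. by rewrite /imB; ring. Qed.

Context {V : normedModType R}.

Lemma is_derive_coords (f : V -> 'rV[R]_4) u h : derivable f u h ->
  [/\ is_derive u h (@x1 R \o f) (x1 ('D_h f u)),
      is_derive u h (@x2 R \o f) (x2 ('D_h f u)),
      is_derive u h (@y1 R \o f) (y1 ('D_h f u)) &
      is_derive u h (@y2 R \o f) (y2 ('D_h f u))].
Proof. by move=> df; split; exact: derive_coord. Qed.

Lemma is_derive_reB (f g : V -> 'rV[R]_4) u h :
  derivable f u h -> derivable g u h ->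
  is_derive u h (fun z => reB (f z) (g z)) (reB ('D_h f u) (g u) +
    reB (f u) ('D_h g u)).
Proof.
move=> /is_derive_coords [f1 f2 f3 f4] /is_derive_coords [g1 g2 g3 g4].
apply: (is_derive_eq (is_deriveD
  (is_deriveD (is_deriveM f1 g3) (is_deriveM f3 g1))
  (is_deriveD (is_deriveM f2 g4) (is_deriveM f4 g2)))).
by move: ('D_h f u) ('D_h g u) => a b; rewrite /reB /GRing.scale /=; ring.
Qed.

Lemma is_derive_imB (f g : V -> 'rV[R]_4) u h :
  derivable f u h -> derivable g u h ->
  is_derive u h (fun z => imB (f z) (g z)) (imB ('D_h f u) (g u) +
    imB (f u) ('D_h g u)).
Proof.
move=> /is_derive_coords [f1 f2 f3 f4] /is_derive_coords [g1 g2 g3 g4].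
apply: (is_derive_eq (is_deriveB
  (is_deriveD (is_deriveM f2 g3) (is_deriveM f3 g2))
  (is_deriveD (is_deriveM f1 g4) (is_deriveM f4 g1)))).
by move: ('D_h f u) ('D_h g u) => a b; rewrite /imB /GRing.scale /=; ring.
Qed.

Lemma is_derive_dotv (f g : V -> 'rV[R]_4) u h :
  derivable f u h -> derivable g u h ->
  is_derive u h (fun z => dotv (f z) (g z)) (dotv ('D_h f u) (g u) +
    dotv (f u) ('D_h g u)).
Proof.
move=> /is_derive_coords [f1 f2 f3 f4] /is_derive_coords [g1 g2 g3 g4].
rewrite (_ : (fun z => dotv (f z) (g z)) =
  (fun z => x1 (f z) * x1 (g z) + x2 (f z) * x2 (g z) +
  y1 (f z) * y1 (g z) + y2 (f z) * y2 (g z))); last first.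
  by apply/funext => z; rewrite dotv4E.
apply: (is_derive_eq (is_deriveD (is_deriveD
  (is_deriveD (is_deriveM f1 g1) (is_deriveM f2 g2))
  (is_deriveM f3 g3)) (is_deriveM f4 g4))).
by move: ('D_h f u) ('D_h g u) => a b; rewrite !dotv4E /GRing.scale /=; ring.
Qed.

End Forms.

(** * Linear algebra of the tangent planes *)

Section Quadric.
Context {R : realType}.
Implicit Types p q v w : 'rV[R]_4.

Definition quadric (c : R) : set 'rV[R]_4 :=
  [set p | reB p p = 2 * c /\ imB p p = 0].

Definition quadric_tangent p : set 'rV[R]_4 :=
  [set v | reB p v = 0 /\ imB p v = 0].

Lemma quadric_x_neq0 c p : c != 0 -> quadric c p -> 0 < x1 p ^+ 2 + x2 p ^+ 2.
Proof.
move=> c0 [re _]; rewrite lt0r addr_ge0 ?sqr_ge0// andbT.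
apply: contra c0; rewrite paddr_eq0 ?sqr_ge0// !sqrf_eq0 => /andP[/eqP a0 /eqP b0].
by apply/eqP; move: re; rewrite /reB a0 b0; lra.
Qed.

(** With x nonzero, the equation x conj eta + xi conj y = 0 reads
    conj eta = m xi for the complex number m = m1 + i m2 = - conj y / x. *)
Lemma quadric_tangent_slope p : 0 < x1 p ^+ 2 + x2 p ^+ 2 ->
  exists m1 m2 : R, forall v, quadric_tangent p v ->
    y1 v = m1 * x1 v - m2 * x2 v /\ y2 v = - (m1 * x2 v + m2 * x1 v).
Proof.
move=> p0; set d := x1 p ^+ 2 + x2 p ^+ 2; have d0 : d != 0 by exact: lt0r_neq0.
exists ((x2 p * y2 p - x1 p * y1 p) / d), ((y1 p * x2 p + y2 p * x1 p) / d).
move=> v [re im].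
have e1 : d * y1 v =
    (x2 p * y2 p - x1 p * y1 p) * x1 v - (y1 p * x2 p + y2 p * x1 p) * x2 v.
  have -> : d * y1 v = x1 p * reB p v + x2 p * imB p v +
    ((x2 p * y2 p - x1 p * y1 p) * x1 v - (y1 p * x2 p + y2 p * x1 p) * x2 v).
    by rewrite /reB /imB /d; ring.
  by rewrite re im; ring.
have e2 : d * y2 v =
    - ((x2 p * y2 p - x1 p * y1 p) * x2 v + (y1 p * x2 p + y2 p * x1 p) * x1 v).
  have -> : d * y2 v = x2 p * reB p v - x1 p * imB p v +
    - ((x2 p * y2 p - x1 p * y1 p) * x2 v + (y1 p * x2 p + y2 p * x1 p) * x1 v).
    by rewrite /reB /imB /d; ring.
  by rewrite re im; ring.
by split; apply: (mulfI d0); rewrite ?e1 ?e2; field.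
Qed.

Lemma quadric_tangent_lagrangian p v w : 0 < x1 p ^+ 2 + x2 p ^+ 2 ->
  quadric_tangent p v -> quadric_tangent p w -> omega0 v w = 0.
Proof.
move=> /quadric_tangent_slope[m1 [m2 mP]] /mP[v1 v2] /mP[w1 w2].
by rewrite /omega0 v1 v2 w1 w2; ring.
Qed.

(** The area form of the x-plane, which is a coordinate plane for every tangent
    plane of the quadric. *)
Definition xdet v w : R := x1 v * x2 w - x2 v * x1 w.

Lemma quadric_tangent_xdet p v w : 0 < x1 p ^+ 2 + x2 p ^+ 2 ->
  quadric_tangent p v -> quadric_tangent p w -> xdet v w = 0 ->
  exists s t : R, (s != 0) || (t != 0) /\ s *: v + t *: w = 0.
Proof.
move=> p0 Tv Tw vw.
have [m1 [m2 mP]] := quadric_tangent_slope p p0.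
have x0 z : quadric_tangent p z -> x1 z = 0 -> x2 z = 0 -> z = 0.
  move=> /mP[z1 z2] h1 h2.
  apply: eq_vec4; rewrite ?h1 ?h2 ?z1 ?z2 ?h1 ?h2 /x1 /x2 /y1 /y2 mxE; ring.
have lin s t z z' : quadric_tangent p z -> quadric_tangent p z' ->
    quadric_tangent p (s *: z + t *: z').
  by move=> [h1 h2] [h3 h4]; split; rewrite linearD !linearZ /= ?h1 ?h2 ?h3 ?h4;
    rewrite !mulr0 addr0.
have xs (s t : R) : [/\ x1 (s *: v + t *: w) = s * x1 v + t * x1 w &
   x2 (s *: v + t *: w) = s * x2 v + t * x2 w] by rewrite /x1 /x2 !mxE.
have [/eqP v10|v10] := boolP (x1 v == 0); last first.
  exists (- x1 w), (x1 v); split; first by rewrite v10 orbT.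
  have [h1 h2] := xs (- x1 w) (x1 v); apply: x0; first exact: lin.
    by rewrite h1; ring.
  by rewrite h2 -[RHS]vw /xdet; ring.
have [/eqP v20|v20] := boolP (x2 v == 0); last first.
  exists (- x2 w), (x2 v); split; first by rewrite v20 orbT.
  have [h1 h2] := xs (- x2 w) (x2 v); apply: x0; first exact: lin.
    by rewrite h1 -[RHS]oppr0 -[in RHS]vw /xdet; ring.
  by rewrite h2; ring.
exists 1, 0; split; first by rewrite oner_neq0.
by rewrite scale1r scale0r addr0; exact: x0.
Qed.

(** With conj eta = m xi the complex form is 2 m xi xi', while the scalar
    products are (1 + |m|^2) Re (xi conj xi'); the claim is the identity
    |w|^2 v^2 - 2 Re (v conj w) v w + |v|^2 w^2 = 0 between complex numbers.
    The left-hand sides are, up to the determinant of the Gram matrix, the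
    traces of reB and imB in the basis v, w. *)
Lemma quadric_trace_free p v w : 0 < x1 p ^+ 2 + x2 p ^+ 2 ->
  quadric_tangent p v -> quadric_tangent p w ->
  dotv w w * reB v v - 2 * dotv v w * reB v w + dotv v v * reB w w = 0 /\
  dotv w w * imB v v - 2 * dotv v w * imB v w + dotv v v * imB w w = 0.
Proof.
move=> /quadric_tangent_slope[m1 [m2 mP]] /mP[v1 v2] /mP[w1 w2].
by split; rewrite !dotv4E /reB /imB v1 v2 w1 w2; ring.
Qed.

Lemma quadric_gram p v w : 0 < x1 p ^+ 2 + x2 p ^+ 2 ->
  quadric_tangent p v -> quadric_tangent p w -> xdet v w != 0 ->
  dotv v v * dotv w w - dotv v w * dotv v w != 0.
Proof.
move=> /quadric_tangent_slope[m1 [m2 mP]] /mP[v1 v2] /mP[w1 w2] vw.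
have -> : dotv v v * dotv w w - dotv v w * dotv v w =
   ((1 + m1 ^+ 2 + m2 ^+ 2) * xdet v w) ^+ 2.
  by rewrite !dotv4E /xdet v1 v2 w1 w2; ring.
rewrite sqrf_eq0 mulf_neq0// lt0r_neq0// -addrA ltr_wpDr//.
by rewrite addr_ge0 ?sqr_ge0.
Qed.

(** The plane is spanned by v and w, and the metric restricted to it is
    1 + |m|^2 times the metric of the x-plane, hence definite. *)
Lemma quadric_tangent_orth p v w z : 0 < x1 p ^+ 2 + x2 p ^+ 2 ->
  quadric_tangent p v -> quadric_tangent p w -> xdet v w != 0 ->
  quadric_tangent p z -> dotv z v = 0 -> dotv z w = 0 -> z = 0.
Proof.
move=> /quadric_tangent_slope[m1 [m2 mP]] /mP[v1' v2'] /mP[w1 w2] vw /mP[z1 z2].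
rewrite !dotv4E v1' v2' w1 w2 z1 z2 => zv zw.
set M := 1 + m1 ^+ 2 + m2 ^+ 2.
have M0 : M != 0.
  by rewrite lt0r_neq0// /M -addrA ltr_wpDr// addr_ge0 ?sqr_ge0.
have e1 : x1 z = 0.
  apply: (mulfI M0); apply: (mulfI vw); rewrite !mulr0 -[RHS](subrr 0).
  by rewrite -[in X in _ = X - _](mulr0 (x2 w))
    -[in X in _ = _ - X](mulr0 (x2 v)) -[in X in _ = X - _]zv -[in X in _ = _ -
      X]zw /xdet /M; ring.
have e2 : x2 z = 0.
  apply: (mulfI M0); apply: (mulfI vw); rewrite !mulr0 -[RHS](subrr 0).
  by rewrite -[in X in _ = X - _](mulr0 (x1 v))
    -[in X in _ = _ - X](mulr0 (x1 w)) -[in X in _ = X - _]zw -[in X in _ = _ -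
      X]zv /xdet /M; ring.
by apply: eq_vec4; rewrite ?z1 ?z2 ?e1 ?e2 /x1 /x2 /y1 /y2 mxE; ring.
Qed.

End Quadric.

Section DiffForms.
Context {R : realType} {V : normedModType R}.
Implicit Types f g : V -> 'rV[R]_4.

Lemma differentiable_coords f u : differentiable f u ->
  [/\ differentiable (@x1 R \o f) u, differentiable (@x2 R \o f) u,
      differentiable (@y1 R \o f) u & differentiable (@y2 R \o f) u].
Proof.
by move=> df; split; apply: differentiable_comp df _; exact: differentiable_coord.
Qed.

Lemma differentiable_reB f g u : differentiable f u -> differentiable g u ->
  differentiable (fun z => reB (f z) (g z)) u.
Proof.
move=> /differentiable_coords [f1 f2 f3 f4] /differentiable_coords [g1 g2 g3 g4].
exact: (differentiableD
  (differentiableD (differentiableM f1 g3) (differentiableM f3 g1))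
  (differentiableD (differentiableM f2 g4) (differentiableM f4 g2))).
Qed.

Lemma differentiable_imB f g u : differentiable f u -> differentiable g u ->
  differentiable (fun z => imB (f z) (g z)) u.
Proof.
move=> /differentiable_coords [f1 f2 f3 f4] /differentiable_coords [g1 g2 g3 g4].
exact: (differentiableB
  (differentiableD (differentiableM f2 g3) (differentiableM f3 g2))
  (differentiableD (differentiableM f1 g4) (differentiableM f4 g1))).
Qed.

Lemma differentiable_dotv f g u : differentiable f u -> differentiable g u ->
  differentiable (fun z => dotv (f z) (g z)) u.
Proof.
move=> /differentiable_coords [f1 f2 f3 f4] /differentiable_coords [g1 g2 g3 g4].
rewrite (_ : (fun z => dotv (f z) (g z)) =
  (fun z => x1 (f z) * x1 (g z) + x2 (f z) * x2 (g z) +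
  y1 (f z) * y1 (g z) + y2 (f z) * y2 (g z))); last first.
  by apply/funext => z; rewrite dotv4E.
exact: (differentiableD (differentiableD
  (differentiableD (differentiableM f1 g1) (differentiableM f2 g2))
  (differentiableM f3 g3)) (differentiableM f4 g4)).
Qed.

End DiffForms.

(** * Arbitrary charts of the quadric *)

Section Dimension2.
Context {R : realType}.

Lemma rV2_delta (h : 'rV[R]_2) : h = h 0 0 *: delta_mx 0 0 + h 0 1 *: delta_mx 0 1.
Proof.
apply/rowP => -[[|[|//]]] i; rewrite !mxE /= ?mulr1 ?mulr0 ?addr0 ?add0r;
  by congr (h _ _); exact: val_inj.
Qed.

Lemma det2 (A : 'M[R]_2) : \det A = A 0 0 * A 1 1 - A 0 1 * A 1 0.
Proof.
rewrite (expand_det_row _ 0) !big_ord_recl big_ord0 addr0 /cofactor !det_mx11 !mxE /=.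
rewrite expr0 expr1 mul1r mulN1r mulrN; congr (_ * A _ _ - A _ _ * A _ _);
  exact: val_inj.
Qed.

End Dimension2.

Section ChartsOfQuadric.
Context {R : realType} {S : set 'rV[R]_4} {c : R}.
Hypotheses (c0 : c != 0) (Sc : S `<=` quadric c).
Context {X : 'rV[R]_2 -> 'rV[R]_4} {U : set 'rV[R]_2}.
Hypothesis chX : chart S X U.

Lemma chart_open : open U. Proof. by case: chX. Qed.

Lemma chart_smooth : smooth_on U X. Proof. by case: chX. Qed.

Lemma chart_diff u : U u -> differentiable X u.
Proof. by move=> Uu; have [d _] := chart_smooth 1%N; exact: d. Qed.

Lemma chart_diff_partial j u : U u -> differentiable (partial j X) u.
Proof.
by move=> Uu; have [_ /(_ (delta_mx 0 j)) [d _]] := chart_smooth 2%N; exact: d.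
Qed.

Lemma chart_mem u : U u -> half_plane u -> S (X u).
Proof.
move=> Uu Hu; have [_ _ _ [V _ imX] _] := chX.
suff : (S `&` V) (X u) by case.
by rewrite -imX; exists u.
Qed.

Lemma chart_x_neq0 u : U u -> half_plane u -> 0 < x1 (X u) ^+ 2 + x2 (X u) ^+ 2.
Proof. by move=> Uu Hu; apply: quadric_x_neq0 c0 _; exact/Sc/chart_mem. Qed.

(** Differentiate the two equations along X; the polar forms are symmetric. *)
Lemma chart_tangent u h : U u -> half_plane u -> quadric_tangent (X u) ('D_h X u).
Proof.
move=> Uu Hu; have dXu := chart_diff _ Uu.
have DX := @diff_derivable _ _ _ _ _ h dXu.
have half (a : R) : a + a = 0 -> a = 0 by move=> ?; lra.
split; apply: half.
  have d := is_derive_reB X X u h DX DX.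
  rewrite -[LHS]/(reB (X u) ('D_h X u) +
    reB (X u) ('D_h X u)) {1}reBC -(@derive_val _ _ _ _ _ _ _ d).
  apply: (derive_cst_half_plane U _ u (2 * c) chart_open Uu Hu).
    exact: differentiable_reB.
  by move=> z Uz Hz; have [] := Sc _ (chart_mem _ Uz Hz).
have d := is_derive_imB X X u h DX DX.
rewrite {1}imBC -(@derive_val _ _ _ _ _ _ _ d).
apply: (derive_cst_half_plane U _ u 0 chart_open Uu Hu).
  exact: differentiable_imB.
by move=> z Uz Hz; have [] := Sc _ (chart_mem _ Uz Hz).
Qed.

(** Differentiate the tangency of the j-th partial derivative in the i-th
    direction. *)
Lemma chart_second u i j : U u -> half_plane u ->
  reB (X u) (partial i (partial j X) u) = - reB (partial i X u) (partial j X u) /\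
  imB (X u) (partial i (partial j X) u) = - imB (partial i X u) (partial j X u).
Proof.
move=> Uu Hu; have dXu := chart_diff _ Uu; have dXj := chart_diff_partial j _ Uu.
have DX := @diff_derivable _ _ _ _ _ (delta_mx 0 i) dXu.
have DXj := @diff_derivable _ _ _ _ _ (delta_mx 0 i) dXj.
split; apply/eqP; rewrite -addr_eq0 addrC; apply/eqP.
  have d := is_derive_reB _ _ _ _ DX DXj.
  rewrite -(@derive_val _ _ _ _ _ _ _ d).
  apply: (derive_cst_half_plane U _ u 0 chart_open Uu Hu).
    exact: differentiable_reB.
  by move=> z Uz Hz; have [] := chart_tangent z (delta_mx 0 j) Uz Hz.
have d := is_derive_imB _ _ _ _ DX DXj.
rewrite -(@derive_val _ _ _ _ _ _ _ d).
apply: (derive_cst_half_plane U _ u 0 chart_open Uu Hu).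
  exact: differentiable_imB.
by move=> z Uz Hz; have [] := chart_tangent z (delta_mx 0 j) Uz Hz.
Qed.

Lemma chart_deriveE u h : U u ->
  'D_h X u = h 0 0 *: partial 0 X u + h 0 1 *: partial 1 X u.
Proof.
move=> Uu; have dXu := chart_diff _ Uu.
rewrite /partial !deriveE// -!linearZ -linearD; congr ('d X u _).
exact: rV2_delta.
Qed.

(** If the x-components of the two partial derivatives were dependent, some
    nonzero direction would be mapped to a tangent vector with xi = 0, which is
    0, against the injectivity of the differential. *)
Lemma chart_xdet u : U u -> half_plane u ->
  xdet (partial 0 X u) (partial 1 X u) != 0.
Proof.
move=> Uu Hu; apply/negP => /eqP xd.
have [s [t [st e]]] := quadric_tangent_xdet (X u) _ _ (chart_x_neq0 _ Uu Hu)
  (chart_tangent u (delta_mx 0 0) Uu Hu) (chart_tangent u (delta_mx 0 1) Uu Hu) xd.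
pose h : 'rV[R]_2 := s *: delta_mx 0 0 + t *: delta_mx 0 1.
have [_ _ imm _ _] := chX.
have dXu := chart_diff _ Uu.
have : 'd X u h = 'd X u 0.
  by rewrite linear0 linearD !linearZ -e !deriveE.
move=> /(imm u Uu) /rowP h0.
have := h0 0; have := h0 1; rewrite !mxE /= !(mulr1, mulr0, addr0, add0r) => t0 s0.
by move: st; rewrite s0 t0 eqxx.
Qed.

Lemma chart_gram_unit u : U u -> half_plane u -> gram X u \in unitmx.
Proof.
move=> Uu Hu; rewrite unitmxE unitfE det2 !mxE.
have := quadric_gram (X u) _ _ (chart_x_neq0 _ Uu Hu)
  (chart_tangent u (delta_mx 0 0) Uu Hu) (chart_tangent u (delta_mx 0 1) Uu Hu)
  (chart_xdet _ Uu Hu).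
rewrite /partial; move: ('D_(delta_mx 0 0) X u) ('D_(delta_mx 0 1) X u) => v w.
by rewrite (dotvC w v).
Qed.

End ChartsOfQuadric.

(** * Mean curvature *)

Section Minimal.
Context {R : realType}.

(** Cramer's rule for 2 x 2 matrices: contraction of the inverse matrix with f,
    without denominators. *)
Lemma invmx2_sum (A : 'M[R]_2) (f : 'I_2 -> 'I_2 -> R) : A \in unitmx ->
  (\det A) * (\sum_i \sum_j invmx A i j * f i j) =
  A 1 1 * f 0 0 - A 0 1 * f 0 1 - A 1 0 * f 1 0 + A 0 0 * f 1 1.
Proof.
move=> Au.
have E i j : \det A * invmx A i j = (\adj A) i j.
  rewrite /invmx Au mxE mulrA mulfV ?mul1r//.
  by rewrite unitmxE unitfE in Au.
rewrite mulr_sumr; under eq_bigr => i _.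
  rewrite mulr_sumr; under eq_bigr => j _ do rewrite mulrA E.
  over.
have o1 : ord_max = 1 :> 'I_2 by exact: val_inj.
have o0 : widen_ord (leqnSn 1) ord_max = 0 :> 'I_2 by exact: val_inj.
rewrite !(big_ord_recr, big_ord0) /= !add0r ?o0 ?o1 !mxE /cofactor !det_mx11 !mxE /=.
have l0 : lift 1 0 = 0 :> 'I_2 by exact: val_inj.
have l1 : lift 0 0 = 1 :> 'I_2 by exact: val_inj.
rewrite ?l0 ?l1 /= ?expr0 ?expr1; ring.
Qed.

Lemma gramE (X : 'rV[R]_2 -> 'rV[R]_4) u i j :
  gram X u i j = dotv (partial i X u) (partial j X u).
Proof. by rewrite mxE. Qed.

Lemma scalar_normal_part (l : {scalar 'rV[R]_4}) (X : 'rV[R]_2 -> 'rV[R]_4) u v :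
  (forall k, l (partial k X u) = 0) -> l (normal_part X u v) = l v.
Proof.
move=> l0; rewrite /normal_part linearB linear_sum big1 ?subr0// => i _.
by rewrite linear_sum big1// => j _; rewrite linearZ l0 /= mulr0.
Qed.

Lemma scalar_mean_curvature (l : {scalar 'rV[R]_4}) (X : 'rV[R]_2 -> 'rV[R]_4) u :
  l (mean_curvature X u) = \sum_i \sum_j
    invmx (gram X u) i j * l (normal_part X u (partial i (partial j X) u)).
Proof.
rewrite /mean_curvature linear_sum; apply: eq_bigr => i _.
by rewrite linear_sum; apply: eq_bigr => j _; rewrite linearZ.
Qed.

(** Applied to the scalar product with the k-th partial derivative, this says
    that the normal part is indeed normal. *)
Lemma scalar_normal_part_gram (l : {scalar 'rV[R]_4}) (X : 'rV[R]_2 ->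
  'rV[R]_4) u v k :
  gram X u \in unitmx -> (forall j, l (partial j X u) = gram X u j k) ->
  l (normal_part X u v) = l v - dotv v (partial k X u).
Proof.
move=> gu lG; rewrite /normal_part linearB linear_sum; congr (_ - _).
pose d := fun i => dotv v (partial i X u).
transitivity (\sum_i d i * (invmx (gram X u) *m gram X u) i k).
  apply: eq_bigr => i _; rewrite linear_sum mxE mulr_sumr.
  by apply: eq_bigr => j _; rewrite linearZ lG /= mulrAC mulrC [dotv _ _ * _]mulrC.
rewrite -/(d k); move: d => d; rewrite (mulVmx gu).
rewrite (bigD1 k)//= mxE eqxx mulr1 big1 ?addr0// => i /negPf ik.
by rewrite mxE ik mulr0.
Qed.

(** In the application l is dq at the point and b the Hessian form of q, for q
    one of the two quadratic equations: lb is the equation q o X = cst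
    differentiated twice, and the last hypothesis says that b is trace free. *)
Lemma scalar_mean_curvature0 (l : {scalar 'rV[R]_4}) (b : 'rV[R]_4 -> 'rV[R]_4 -> R)
    (X : 'rV[R]_2 -> 'rV[R]_4) u (v := partial 0 X u) (w := partial 1 X u) :
  gram X u \in unitmx ->
  (forall k, l (partial k X u) = 0) -> (forall p q, b p q = b q p) ->
  (forall i j, l (partial i (partial j X) u) = - b (partial i X u) (partial j X u)) ->
  dotv w w * b v v - 2 * dotv v w * b v w + dotv v v * b w w = 0 ->
  l (mean_curvature X u) = 0.
Proof.
move=> gu l0 bC lb tr; have dG : \det (gram X u) != 0 by rewrite unitmxE unitfE in gu.
have lE i j : l (normal_part X u (partial i (partial j X) u)) =
    - b (partial i X u) (partial j X u) by rewrite scalar_normal_part.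
have HE : l (mean_curvature X u) =
    \sum_i \sum_j invmx (gram X u) i j * - b (partial i X u) (partial j X u).
  rewrite scalar_mean_curvature; apply: eq_bigr => i _; apply: eq_bigr => j _.
  by rewrite lE.
apply: (mulfI dG); rewrite HE mulr0.
rewrite (invmx2_sum _ (fun i j => - b (partial i X u) (partial j X u)) gu).
rewrite (gramE _ _ 0 0) (gramE _ _ 1 1) (gramE _ _ 1 0) (gramE _ _ 0 1) -/v -/w.
clear HE lE lb; clearbody v w; rewrite (bC w v) (dotvC w v).
by rewrite -[RHS]oppr0 -[in RHS]tr; ring.
Qed.

Context {S : set 'rV[R]_4} {c : R}.
Hypotheses (c0 : c != 0) (Sc : S `<=` quadric c).

(** The mean curvature is orthogonal to the surface by construction, and the
    trace identity makes it annihilate both equations, hence tangent. *)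
Lemma minimal_quadric : minimal S.
Proof.
move=> X U u p [chX Uu Hu _].
have gu := chart_gram_unit c0 Sc chX u Uu Hu.
have x0 := chart_x_neq0 c0 Sc chX u Uu Hu.
have T k : quadric_tangent (X u) (partial k X u).
  exact: (chart_tangent Sc chX u (delta_mx 0 k) Uu Hu).
have [tre tim] := quadric_trace_free (X u) _ _ x0 (T 0) (T 1).
have H2 i j := chart_second Sc chX u i j Uu Hu.
have HN k : dotv (mean_curvature X u) (partial k X u) = 0.
  rewrite dotvC scalar_mean_curvature big1// => i _; rewrite big1// => j _.
  rewrite (scalar_normal_part_gram _ _ _ _ k gu) => [|j'];
    last by rewrite gramE dotvC.
  by rewrite dotvC subrr mulr0.
apply: (quadric_tangent_orth (X u) _ _ _ x0 (T 0) (T 1)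
  (chart_xdet c0 Sc chX _ Uu Hu) _ (HN 0) (HN 1)).
split.
  apply: (scalar_mean_curvature0 (reB (X u)) _ _ _ gu _ reBC) tre => [k|i j].
    exact: (T k).1.
  exact: (H2 i j).1.
apply: (scalar_mean_curvature0 (imB (X u)) _ _ _ gu _ imBC) tim => [k|i j].
  exact: (T k).2.
exact: (H2 i j).2.
Qed.

Lemma tangent_quadric p : tangent S p `<=` quadric_tangent p.
Proof.
move=> _ [X [U [u [h [[chX Uu Hu <-] ->]]]]].
have <- := deriveE h (chart_diff chX _ Uu).
exact: (chart_tangent Sc chX u h Uu Hu).
Qed.

Lemma lagrangian_quadric : lagrangian S.
Proof.
move=> p v w Sp Tv Tw; apply: (quadric_tangent_lagrangian p).
- exact: quadric_x_neq0 c0 (Sc p Sp).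
- exact: tangent_quadric.
- exact: tangent_quadric.
Qed.

End Minimal.

(** * The truncated catenoid as a quadric and as a graph *)

Section Catenoid.
Context {R : realType}.

Definition vec2 (a b : R) : 'rV[R]_2 := \row_(j < 2) [:: a; b]`_j.

Lemma vec2E a b : (vec2 a b 0 0 = a) * (vec2 a b 0 1 = b).
Proof. by rewrite !mxE. Qed.

(** acos recovers the angle up to sign, and the sign of b selects the half
    turn. *)
Lemma polar_angle (a b : R) : a ^+ 2 + b ^+ 2 = 1 ->
  exists phi, [/\ 0 <= phi < 2 * pi, cos phi = a & sin phi = b].
Proof.
move=> ab; have a1 : -1 <= a <= 1.
  rewrite -ler_norml -(@ler_pXn2r _ 2)// ?nnegrE//.
  by rewrite real_normK ?num_real// expr1n -ab lerDl sqr_ge0.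
have ca : cos (acos a) = a by rewrite acosK.
have sa : sin (acos a) = `|b|.
  rewrite sin_acos// (_ : 1 - a ^+ 2 = b ^+ 2) ?sqrtr_sqr//.
  by rewrite -ab; ring.
have pi0 := pi_gt0 R.
have [b0|b0] := leP 0 b.
  exists (acos a); split=> //; last by rewrite sa ger0_norm.
  rewrite acos_ge0//=; apply: le_lt_trans (acos_lepi a1) _; lra.
have -> : 2 * pi = pi *+ 2 :> R by rewrite mulr_natl.
exists (- acos a + pi *+ 2); split.
- have p0 : 0 < acos a.
    apply: acos_gt0; case/andP: a1 => -> a1 /=; rewrite lt_neqAle a1 andbT.
    apply/eqP => a1'; move: ab; rewrite a1' expr1n => /eqP.
    rewrite -subr_eq0 addrC addKr sqrf_eq0 => /eqP b00.
    by rewrite b00 ltxx in b0.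
  have := acos_lepi a1; rewrite mulr2n => ap; apply/andP; split; lra.
- by rewrite cosD2pi cosN.
- by rewrite sinD2pi sinN sa ltr0_norm// opprK.
Qed.

Lemma enorm_le1 (p : 'rV[R]_4) : (enorm p <= 1) = (dotv p p <= 1).
Proof. by rewrite /enorm -[X in _ <= X]sqrtr1 ler_sqrt. Qed.

Lemma enorm_eq1 (p : 'rV[R]_4) : (enorm p = 1) <-> (dotv p p = 1).
Proof.
rewrite /enorm; split => [e|->]; last by rewrite sqrtr1.
have p0 : 0 <= dotv p p by rewrite dotv4E -!expr2 !addr_ge0 ?sqr_ge0.
by rewrite -(sqr_sqrtr p0) e expr1n.
Qed.

Lemma coordZ (k : R) p : [/\ x1 (k *: p) = k * x1 p, x2 (k *: p) = k * x2 p,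
  y1 (k *: p) = k * y1 p & y2 (k *: p) = k * y2 p].
Proof. by rewrite /x1 /x2 /y1 /y2 !mxE. Qed.

Lemma quadricP (c : R) p : quadric c p <->
  x1 p * y1 p + x2 p * y2 p = c /\ x2 p * y1 p = x1 p * y2 p.
Proof.
rewrite /quadric /reB /imB /=; split => -[h1 h2]; split.
- by lra.
- by lra.
- by rewrite -h1; ring.
- by rewrite [y1 p * _]mulrC h2; ring.
Qed.

(** Multiply x conj y = c by x and conjugate. *)
Lemma quadric_y (c : R) p : c != 0 -> quadric c p ->
  let d := x1 p ^+ 2 + x2 p ^+ 2 in
  y1 p = c / d * x1 p /\ y2 p = c / d * x2 p.
Proof.
move=> c0 qp d; have d0 : d != 0 by apply/lt0r_neq0; exact: quadric_x_neq0 c0 qp.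
have /quadricP[h1 h2] := qp.
split; apply: (mulfI d0).
  transitivity (c * x1 p); last by field.
  rewrite -h1 /d; transitivity (x1 p ^+ 2 * y1 p + x2 p * (x2 p * y1 p)); first ring.
  by rewrite h2; ring.
transitivity (c * x2 p); last by field.
rewrite -h1 /d; transitivity (x2 p ^+ 2 * y2 p + x1 p * (x1 p * y2 p)); first ring.
by rewrite -h2; ring.
Qed.

(** The parameters of a point of the quadric are t = r0 |x| and the argument
    of x. *)
Lemma truncated_catenoidE (r0 : R) : 0 < r0 ->
  truncated_catenoid r0 = quadric (r0 ^- 2) `&` @B4 R.
Proof.
move=> r00; have r0n : r0 != 0 by exact: lt0r_neq0.
apply/seteqP; split => p [Hp Bp]; split=> //.
  have [_ [t [phi [t0 _ ->]]] <-] := Hp.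
  have tn : t != 0 by exact: lt0r_neq0.
  apply/quadricP.
  have [-> -> -> ->] := coordZ r0^-1 (vec4 (t * cos phi) (t * sin phi) (t^-1 *
    cos phi) (t^-1 * sin phi)).
  have [-> -> -> ->] := vec4E (t * cos phi) (t * sin phi) (t^-1 * cos phi) (t^-1 *
    sin phi).
  split; last by ring.
  transitivity (r0 ^- 2 * (cos phi ^+ 2 + sin phi ^+ 2)); first by field;
    rewrite r0n tn.
  by rewrite cos2Dsin2 mulr1.
set c := r0 ^- 2 in Hp.
have c0 : c != 0 by rewrite invr_eq0 expf_neq0.
have := quadric_y c p c0 Hp; set d := x1 p ^+ 2 + x2 p ^+ 2 => -[e1 e2].
have dgt0 : 0 < d by exact: quadric_x_neq0 c0 Hp.
have dn0 : d != 0 by exact: lt0r_neq0.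
pose r := Num.sqrt d; have r2 : r ^+ 2 = d by rewrite sqr_sqrtr// ltW.
have rgt0 : 0 < r by rewrite sqrtr_gt0.
have rn0 : r != 0 by exact: lt0r_neq0.
have [|phi [phi2 cph sph]] := polar_angle (x1 p / r) (x2 p / r).
  by rewrite !expr_div_n r2 -mulrDl -/d divff.
exists (vec4 (r0 * r * cos phi) (r0 * r * sin phi) ((r0 * r)^-1 * cos phi) ((r0 *
  r)^-1 * sin phi)).
  by exists (r0 * r), phi; rewrite mulr_gt0.
have [h1 h2 h3 h4] := vec4E (r0 * r * cos phi) (r0 * r * sin phi) ((r0 * r)^-1 *
  cos phi) ((r0 * r)^-1 * sin phi).
have [k1 k2 k3 k4] := coordZ r0^-1 (vec4 (r0 * r * cos phi) (r0 * r *
  sin phi) ((r0 * r)^-1 * cos phi) ((r0 * r)^-1 * sin phi)).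
apply: eq_vec4; rewrite ?k1 ?k2 ?k3 ?k4 ?h1 ?h2 ?h3 ?h4 ?cph ?sph ?e1 ?e2 -?r2 /c.
- by field; rewrite r0n rn0.
- by field; rewrite r0n rn0.
- by field; rewrite r0n rn0.
- by field; rewrite r0n rn0.
Qed.

(** The sum and the difference of the radii have squares 1 + 2 c and 1 - 2 c. *)
Lemma radii_exist (c : R) : 0 < c < 1 / 2 ->
  exists a b : R, [/\ 0 < a < b, a * b = c & a ^+ 2 + b ^+ 2 = 1].
Proof.
move=> /andP[c0 c1].
pose s := Num.sqrt (1 + 2 * c); pose d := Num.sqrt (1 - 2 * c).
have s2 : s ^+ 2 = 1 + 2 * c by rewrite sqr_sqrtr//; lra.
have d2 : d ^+ 2 = 1 - 2 * c by rewrite sqr_sqrtr//; lra.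
have d0 : 0 < d by rewrite sqrtr_gt0; lra.
have ds : d < s by rewrite ltr_sqrt; lra.
exists ((s - d) / 2), ((s + d) / 2); split.
- by apply/andP; split; lra.
- by transitivity ((s ^+ 2 - d ^+ 2) / 4); [field | rewrite s2 d2; field].
- by transitivity ((s ^+ 2 + d ^+ 2) / 2); [field | rewrite s2 d2; field].
Qed.

Definition catenoid_graph (c : R) (z : 'rV[R]_2) : 'rV[R]_4 :=
  let d := z 0 0 ^+ 2 + z 0 1 ^+ 2 in
  vec4 (z 0 0) (z 0 1) (c / d * z 0 0) (c / d * z 0 1).

Definition punctured_plane : set 'rV[R]_2 := [set z | 0 < z 0 0 ^+ 2 + z 0 1 ^+ 2].

Lemma sqnorm2_continuous :
  continuous (fun z : 'rV[R]_2 => z 0 0 ^+ 2 + z 0 1 ^+ 2).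
Proof.
have Cc j : Ck_on 0 setT (fun z : 'rV[R]_2 => z 0 j) by move=> z _;
  exact: coord_continuous.
suff C : Ck_on 0 setT (fun z : 'rV[R]_2 => z 0 0 ^+ 2 + z 0 1 ^+ 2) by move=> z;
  exact: C.
by apply: (Ck_on_add openT); apply: (Ck_on_mul openT); exact: Cc.
Qed.

Lemma punctured_plane_open : open punctured_plane.
Proof.
rewrite (_ : punctured_plane =
  (fun z : 'rV[R]_2 => z 0 0 ^+ 2 + z 0 1 ^+ 2) @^-1` [set x | 0 < x])//.
by apply: open_comp => [z _|]; [exact: sqnorm2_continuous|exact: open_gt].
Qed.

Lemma catenoid_graph_smooth c : smooth_on punctured_plane (catenoid_graph c).
Proof.
move=> n; have oP := punctured_plane_open.
have C0 := @Ck_on_coord R 1 2 punctured_plane n 0 0 oP.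
have C1 := @Ck_on_coord R 1 2 punctured_plane n 0 1 oP.
have Cd : Ck_on n punctured_plane
    (fun z : 'rV[R]_2 => c / (z 0 0 ^+ 2 + z 0 1 ^+ 2)).
  apply: Ck_on_mul => //; first exact: Ck_on_cst.
  apply: Ck_on_inv => // [z /lt0r_neq0//|].
  by apply: Ck_on_add => //; exact: Ck_on_mul.
by apply: Ck_on_vec4 => //; apply: Ck_on_mul.
Qed.

Lemma catenoid_graphE c z : [/\ x1 (catenoid_graph c z) = z 0 0,
  x2 (catenoid_graph c z) = z 0 1,
  y1 (catenoid_graph c z) = c / (z 0 0 ^+ 2 + z 0 1 ^+ 2) * z 0 0 &
  y2 (catenoid_graph c z) = c / (z 0 0 ^+ 2 + z 0 1 ^+ 2) * z 0 1].
Proof. by rewrite /catenoid_graph; exact: vec4E. Qed.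

Lemma catenoid_graph_quadric c z : punctured_plane z ->
  quadric c (catenoid_graph c z).
Proof.
move=> /lt0r_neq0 d0; apply/quadricP; have [-> -> -> ->] := catenoid_graphE c z.
by split; field.
Qed.

Lemma catenoid_graphK c p : c != 0 -> quadric c p ->
  catenoid_graph c (vec2 (x1 p) (x2 p)) = p.
Proof.
move=> c0 qp; have [e1 e2] := quadric_y c p c0 qp.
have [h1 h2 h3 h4] := catenoid_graphE c (vec2 (x1 p) (x2 p)).
by apply: eq_vec4; rewrite ?h1 ?h2 ?h3 ?h4 !vec2E.
Qed.

End Catenoid.

(** * Invariance of the boundary *)

Lemma diff_near_le {R : realType} {V W : normedModType R} (f : V -> W) u (e : R) :
  0 < e -> differentiable f u ->
  \forall w \near u, `|f w - f u - 'd f u (w - u)| <= e * `|w - u|.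
Proof.
move=> e0 /diff_locally df.
rewrite (near_shift 0) /= subr0.
have /eqaddoP/(_ _ e0) := df.
apply: filter_app; near=> h.
rewrite -[(_ - _ : V -> W) h]/(f (h + u) - (f u + 'd f u h)) /= addrK.
by rewrite opprD addrA.
Unshelve. all: by end_near. Qed.

Lemma rV2_norm {R : realType} (k : 'rV[R]_2) :
  `|k| = `|k 0 0| \/ `|k| = `|k 0 1|.
Proof.
have [->|k0] := eqVneq k 0; first by left; rewrite mxE !normr0.
have /mx_norm_neq0[[i j]] : mx_norm k != 0 by apply: contra_neq k0 => /mx_norm_eq0.
rewrite -[mx_norm k]/(`|k|) ord1 /= => ->.
by case: j => -[|[|//]] j; [left|right]; congr `|k _ _|; exact: val_inj.
Qed.

Section Boundary.
Context {R : realType}.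

Lemma dotv_continuous : continuous (fun q : 'rV[R]_4 => dotv q q).
Proof.
move=> q; apply: differentiable_continuous.
by apply: (differentiable_dotv id id).
Qed.

(** The functionals l 0 and l 1 are the coordinates, in the basis of the
    x-components of the two partial derivatives, of the x-part of a vector: they
    invert the differential of the x-part of X at u. *)
Lemma chart_x_expansion (S : set 'rV[R]_4) c X U u : c != 0 ->
  S `<=` quadric c -> chart S X U -> U u -> half_plane u ->
  exists s t : 'I_2 -> R, let l i q := s i * x1 q + t i * x2 q in
    (forall i, l i (partial 0 X u) = (i == 0)%:R) /\
    \forall w \near u, forall i,
      `|l i (X w) - l i (X u) - (w - u) 0 i| <= 1 / 2 * `|w - u|.
Proof.
move=> c0 Sc chX Uu Hu.
have dX := chart_diff chX u Uu.
have D0 := chart_xdet c0 Sc chX u Uu Hu.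
have DE h := chart_deriveE chX u h Uu.
set v0 := partial 0 X u in D0 DE *; set v1 := partial 1 X u in D0 DE.
(* Cramer's rule for the system s i * x1 + t i * x2. *)
pose s (i : 'I_2) := (if i == 0 then x2 v1 else - x2 v0) / xdet v0 v1.
pose t (i : 'I_2) := (if i == 0 then - x1 v1 else x1 v0) / xdet v0 v1.
exists s, t => l.
have l0 i : l i v0 = (i == 0)%:R.
  clearbody v0 v1; move: D0; rewrite /l /s /t /xdet; case: (i == 0) => D0 /=;
    field => //.
have l1 i : l i v1 = (i == 1)%:R.
  clearbody v0 v1; move: D0; rewrite /l /s /t /xdet; case: i => -[|[|//]] i D0 /=;
    field => //.
have dl i : differentiable (fun z => l i (X z)) u /\
    forall h, 'd (fun z => l i (X z)) u h = h 0 i.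
  have [d1 d2 _ _] := differentiable_coords _ _ dX.
  have df : differentiable (fun z => l i (X z)) u.
    exact: (differentiableD (differentiableZ (s i) d1) (differentiableZ (t i) d2)).
  split=> // h; rewrite -(deriveE h df).
  have [e1 e2 _ _] := is_derive_coords X u h (diff_derivable dX).
  have e := is_deriveD (is_deriveZ (s i) e1) (is_deriveZ (t i) e2).
  rewrite [LHS](@derive_val _ _ _ _ _ _ _ e) DE.
  transitivity (h 0 0 * (i == 0)%:R + h 0 1 * (i == 1)%:R).
    rewrite -(l0 i) -(l1 i); clear - v0 v1; clearbody v0 v1;
      rewrite /l /x1 /x2 !mxE /GRing.scale /=; ring.
  clear -h.
  case: i => -[|[|//]] i /=.
    by rewrite mulr1 mulr0 addr0; congr (h _ _); exact: val_inj.
  by rewrite mulr1 mulr0 add0r; congr (h _ _); exact: val_inj.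
split=> //; near=> w => i; move: i; near: w; apply: filter_forall => i.
have [d dE] := dl i.
have half : 0 < 1 / 2 :> R by lra.
by have := diff_near_le _ u _ half d; apply: filter_app; near=> w; rewrite dE.
Unshelve. all: by end_near. Qed.

(** Suppose |p| < 1 at an edge point u of a chart.  Near p the surface is the
    graph over a neighborhood of the x-part of p, so the point q over
    x(p) - r xi, with xi the x-part of the first partial derivative, lies on the
    surface for small r > 0 and is the image of a point w of the half plane close
    to u.  To first order w - u is (- r, 0), which contradicts w 0 0 >= 0. *)
Lemma bdry_quadric_sphere (S : set 'rV[R]_4) c p : c != 0 ->
  S = quadric c `&` @B4 R -> bdry S p -> dotv p p = 1.
Proof.
move=> c0 SE [X [U [u [[chX Uu Hu Xu] u0]]]].
have Sc : S `<=` quadric c by rewrite SE => q [].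
have Sp : S p by rewrite -Xu; exact: (chart_mem chX).
have := Sp; rewrite SE => -[qp].
rewrite /B4 /= enorm_le1 le_eqVlt => /orP[/eqP//|p1].
exfalso.
have [s [t]] := chart_x_expansion S c X U u c0 Sc chX Uu Hu.
set l := fun i q => _ => -[lv lX].
have [_ _ _ [V oV imX] [Y cY YK]] := chX.
set A := X @` _ in imX cY.
have YX : Y p = u by rewrite -Xu YK.
have Ap : A p by exists u.
have Vp : V p by move: Ap; rewrite imX => -[].
(* Continuity of the inverse chart transports the expansion to the surface. *)
have NY : \forall q \near p, A q -> forall i,
    `|l i (X (Y q)) - l i p - (Y q - u) 0 i| <= 1 / 2 * `|Y q - u|.
  have /(_ p Ap) cYp := (subspace_continuousP _ _).1 cY.
  have : \forall q \near within A (nbhs p), forall i,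
      `|l i (X (Y q)) - l i p - (Y q - u) 0 i| <= 1 / 2 * `|Y q - u|.
    apply: (cYp [set w | forall i,
      `|l i (X w) - l i p - (w - u) 0 i| <= 1 / 2 * `|w - u|]).
    by rewrite -[from_subspace A Y p]/(Y p) YX -Xu; exact: lX.
  by rewrite near_withinE.
pose z := vec2 (x1 p) (x2 p).
have Gz : catenoid_graph c z = p by exact: catenoid_graphK.
have Pz : punctured_plane z.
  by rewrite /punctured_plane /= !vec2E; exact: quadric_x_neq0 c0 qp.
have cG : catenoid_graph c z' @[z' --> z] --> p by rewrite -Gz;
  exact: (catenoid_graph_smooth c 0 z Pz).
(* Moving along h lowers the coordinate l 0 and keeps l 1. *)
pose v := partial 0 X u; pose h := vec2 (- x1 v) (- x2 v).
have nr (P : set 'rV[R]_2) : (\forall z' \near z, P z') -> \forall r \near 0^'+,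
  P (r *: h + z).
  by move=> Pn; apply: cvg_within; exact: near_ray.
pose P := [set q | [/\ dotv q q < 1, V q & A q -> forall i,
    `|l i (X (Y q)) - l i p - (Y q - u) 0 i| <= 1 / 2 * `|Y q - u|]].
have nP : \forall q \near p, P q.
  near=> q; split; near: q; last exact: NY.
    by apply: (dotv_continuous p [set x | x < 1]); apply: open_nbhs_nbhs;
      split=> //; exact: open_lt.
  exact: open_nbhs_nbhs.
have : \forall r \near 0^'+,
    [/\ 0 < r, punctured_plane (r *: h + z) & P (catenoid_graph c (r *: h + z))].
  near=> r; split; near: r.
  - exact: nbhs_right_gt.
  - apply: nr; apply: open_nbhs_nbhs; split=> //; exact: punctured_plane_open.
  - apply: (nr (catenoid_graph c @^-1` P)); exact: (cG P nP).
move=> /filter_ex[r [r0]].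
set q := catenoid_graph c _ => Pq [q1 Vq Nq].
have Aq : A q.
  rewrite imX; split=> //; rewrite SE; split; first exact: catenoid_graph_quadric.
  by rewrite /B4 /= enorm_le1 ltW.
have [w [Uw Hw] Xw] := Aq.
have Yq : Y q = w by rewrite -Xw YK.
have {}Nq := Nq Aq; rewrite Yq Xw in Nq.
have lq i : l i q - l i p = - r * (i == 0)%:R.
  have [e1 e2 _ _] := catenoid_graphE c (r *: h + z).
  rewrite -lv /l e1 e2 !mxE /= -/v; ring.
set k := w - u in Nq; have k0 : 0 <= k 0 0 by rewrite !mxE u0 subr0; exact: Hw.
(* |r + k0| and |k1| are at most |k| / 2, where k = (k0, k1) and r, k0 >= 0:
   impossible, whichever of |k0| and |k1| is the sup norm of k. *)
have N0 := Nq 0; have N1 := Nq 1; rewrite !lq /= ?mulr1 ?mulr0 in N0 N1.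
move: N0 N1; rewrite -opprD normrN sub0r normrN ger0_norm ?addr_ge0 ?(ltW r0)//.
have kk := normr_ge0 (k 0 1).
by have [->|->] := rV2_norm k; rewrite ?(ger0_norm k0); move: r0 k0 kk;
   move: (k 0 0) `|k 0 1|; clear; move=> *; lra.
Unshelve. all: by end_near. Qed.

End Boundary.

(** * The boundary is Legendrian *)

Section Legendrian.
Context {R : realType}.

(** (i x, i y): the velocity at p of the rotations of the angle phi, which
    preserve the catenoid. *)
Definition so2_field (p : 'rV[R]_4) := vec4 (- x2 p) (x1 p) (- y2 p) (y1 p).

(** With y = k x for a real k, tangency to the quadric gives
    <p, v> = (1 - k^2) <x, xi>, and k = 1 would force |x|^2 = c = 1/2.  So xi is
    orthogonal to x, and eta is determined by xi. *)
Lemma quadric_sphere_tangent (c : R) p v : 0 < c < 1 / 2 ->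
  quadric c p -> dotv p p = 1 -> quadric_tangent p v -> dotv p v = 0 ->
  exists s, v = s *: so2_field p.
Proof.
move=> /andP[c0 c1] qp pp [re im] pv.
have cn0 : c != 0 by exact: lt0r_neq0.
have d0 := quadric_x_neq0 c p cn0 qp.
have [e1 e2] := quadric_y c p cn0 qp.
set d := x1 p ^+ 2 + x2 p ^+ 2 in d0 e1 e2; have dn0 : d != 0 by exact: lt0r_neq0.
set k := c / d in e1 e2.
have kd : k * d = c by rewrite /k divfK.
have k1 : 1 - k ^+ 2 != 0.
  have k0 : 0 < k by rewrite divr_gt0.
  rewrite (_ : 1 - k ^+ 2 = (1 - k) * (1 + k)); last by ring.
  apply: mulf_neq0; last by apply: lt0r_neq0; rewrite addr_gt0.
  apply: contraTneq c1 => /eqP; rewrite subr_eq0 => /eqP k1.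
  rewrite -leNgt -kd -k1 mul1r; move: pp; rewrite dotv4E e1 e2 -k1 !mul1r.
  by rewrite /d; lra.
move: re im pv; rewrite /reB /imB dotv4E e1 e2 => re im pv.
have xv : x1 p * x1 v + x2 p * x2 v = 0.
  apply: (mulfI k1); rewrite mulr0 -[RHS](subrr 0)
    -[in X in _ = _ - X](mulr0 k).
  by rewrite -{1}pv -re; ring.
have xy : x1 p * y1 v + x2 p * y2 v = 0.
  by rewrite -[RHS]re -[LHS]addr0 -[in LHS](mulr0 k) -xv; ring.
have [h1 h2 h3 h4] := vec4E (- x2 p) (x1 p) (- y2 p) (y1 p).
exists ((x1 p * x2 v - x2 p * x1 v) / d).
have [k1' k2' k3' k4'] := coordZ ((x1 p * x2 v - x2 p * x1 v) / d) (so2_field p).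
apply: eq_vec4; rewrite ?k1' ?k2' ?k3' ?k4' /so2_field ?h1 ?h2 ?h3 ?h4 ?e1 ?e2;
  apply: (mulfI dn0).
- transitivity (- x2 p * (x1 p * x2 v - x2 p * x1 v)); last by field.
  by rewrite -[LHS]subr0 -[in LHS](mulr0 (x1 p)) -xv /d; ring.
- transitivity (x1 p * (x1 p * x2 v - x2 p * x1 v)); last by field.
  by rewrite -[LHS]subr0 -[in LHS](mulr0 (x2 p)) -xv /d; ring.
- transitivity (- (k * x2 p) * (x1 p * x2 v - x2 p * x1 v)); last by field.
  rewrite -[LHS]subr0 -[in LHS](mulr0 (x1 p)) -xy.
  by rewrite -[LHS]subr0 -[in LHS](mulr0 (x2 p)) -im /d; ring.
- transitivity (k * x1 p * (x1 p * x2 v - x2 p * x1 v)); last by field.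
  rewrite -[LHS]subr0 -[in LHS](mulr0 (x2 p)) -xy.
  by rewrite -[LHS]addr0 -[in LHS](mulr0 (x1 p)) -im /d; ring.
Qed.

Context {S : set 'rV[R]_4} {c : R}.
Hypotheses (c01 : 0 < c < 1 / 2) (SE : S = quadric c `&` @B4 R).

Let c0 : c != 0. Proof. by case/andP: c01 => ? _; exact: lt0r_neq0. Qed.
Let Sc : S `<=` quadric c. Proof. by rewrite SE => q []. Qed.

(** By invariance of the boundary, |X|^2 = 1 along the edge of any chart. *)
Lemma bdry_tangent_so2_field p v : bdry_tangent S p v -> exists s,
  v = s *: so2_field p.
Proof.
move=> [X [U [u [h [[chX Uu Hu Xu] u0 h0 ->]]]]].
have bd z : U z -> z 0 0 = 0 -> dotv (X z) (X z) = 1.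
  move=> Uz z0; apply: (bdry_quadric_sphere S c _ c0 SE).
  by exists X, U, z; split=> //; split=> //; rewrite /half_plane /= z0.
have dX := chart_diff chX u Uu.
have <- := deriveE h dX.
apply: (quadric_sphere_tangent c) => //.
- by apply: Sc; rewrite -Xu; exact: (chart_mem chX).
- by rewrite -Xu; exact: bd.
- by rewrite -Xu; exact: (chart_tangent Sc chX u h Uu Hu).
have DX := @diff_derivable _ _ _ _ _ h dX.
have half (a : R) : a + a = 0 -> a = 0 by move=> ?; lra.
apply: half; rewrite -Xu -[RHS](derive_cst_line U
  (fun z => dotv (X z) (X z)) u 1 (chart_open chX) Uu u0 _ bd h h0).
  have d := is_derive_dotv X X u h DX DX.
  rewrite (@derive_val _ _ _ _ _ _ _ d); congr (_ + _); exact: dotvC.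
exact: differentiable_dotv.
Qed.

Lemma legendrian_boundary_quadric : legendrian_boundary S.
Proof.
split; first by rewrite SE => q [].
  by move=> p bp; apply/enorm_eq1; exact: bdry_quadric_sphere c0 SE bp.
move=> p v [X [U [u [[chX Uu Hu Xu] _]]]] /bdry_tangent_so2_field[s ->].
have /quadricP[_ im] : quadric c p by apply: Sc; rewrite -Xu; exact: (chart_mem chX).
rewrite linearZ /= dotv4E /Jc /so2_field.
have [-> -> -> ->] := vec4E (- y1 p) (- y2 p) (x1 p) (x2 p).
have [-> -> -> ->] := vec4E (- x2 p) (x1 p) (- y2 p) (y1 p).
rewrite (_ : _ + _ = 2 * (x2 p * y1 p - x1 p * y2 p)); last by ring.
by rewrite im subrr !mulr0.
Qed.

End Legendrian.

(** * The annulus *)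

Lemma immersion_ker {R : realType} {V W : normedModType R} (U : set V) (f : V -> W) :
  (forall u, U u -> differentiable f u) ->
  (forall u h, U u -> 'D_h f u = 0 -> h = 0) -> immersion_on U f.
Proof.
move=> df fK u Uu h h' hh'; apply/eqP; rewrite -subr_eq0; apply/eqP.
apply: (fK u) => //; rewrite deriveE; last exact: df.
by rewrite linearB; apply/eqP; rewrite subr_eq0; apply/eqP.
Qed.

Section Annulus.
Context {R : realType} {a b : R}.
Hypotheses (a0 : 0 < a) (ab : a < b) (ab1 : a ^+ 2 + b ^+ 2 = 1).

(** On the quadric |p|^2 = d + a^2 b^2 / d, and a^2, b^2 are the roots of
    d^2 - d + a^2 b^2. *)
Lemma quadric_B4E (p : 'rV[R]_4) (d := x1 p ^+ 2 + x2 p ^+ 2) : quadric (a * b) p ->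
  d * (1 - dotv p p) = (d - a ^+ 2) * (b ^+ 2 - d).
Proof.
move=> qp; have b0 : 0 < b by exact: lt_trans ab.
have c0 : a * b != 0 by rewrite lt0r_neq0// mulr_gt0.
have [] := quadric_y (a * b) p c0 qp; rewrite dotv4E -/d => -> ->.
have d0 : d != 0 by apply: lt0r_neq0; exact: quadric_x_neq0 c0 qp.
transitivity (d - d ^+ 2 - a ^+ 2 * b ^+ 2).
  by rewrite /d; field.
by transitivity ((a ^+ 2 + b ^+ 2) * d - d ^+ 2 - a ^+ 2 * b ^+ 2);
  [rewrite ab1 mul1r|ring].
Qed.

Lemma quadric_B4P (p : 'rV[R]_4) (d := x1 p ^+ 2 + x2 p ^+ 2) : quadric (a * b) p ->
  (dotv p p <= 1) = (a ^+ 2 <= d <= b ^+ 2).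
Proof.
move=> qp; have b0 : 0 < b by exact: lt_trans ab.
have c0 : a * b != 0 by rewrite lt0r_neq0// mulr_gt0.
have d0 : 0 < d by exact: quadric_x_neq0 c0 qp.
have E := quadric_B4E p qp; rewrite -/d in E.
have a2b2 : a ^+ 2 < b ^+ 2 by rewrite ltr_pXn2r ?nnegrE ?(ltW a0) ?(ltW b0).
rewrite -subr_ge0 -(pmulr_rge0 _ d0) E.
apply/idP/andP => [h|[h1 h2]]; last by rewrite mulr_ge0// subr_ge0.
by split; rewrite leNgt; apply/negP => h'; nra.
Qed.

Lemma quadric_S3P (p : 'rV[R]_4) (d := x1 p ^+ 2 + x2 p ^+ 2) : quadric (a * b) p ->
  dotv p p = 1 <-> d = a ^+ 2 \/ d = b ^+ 2.
Proof.
move=> qp; have b0 : 0 < b by exact: lt_trans ab.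
have c0 : a * b != 0 by rewrite lt0r_neq0// mulr_gt0.
have d0 : d != 0 by apply: lt0r_neq0; exact: quadric_x_neq0 c0 qp.
have E := quadric_B4E p qp; rewrite -/d in E.
split=> [pp|h].
  move: E; rewrite pp subrr mulr0 => /esym/eqP; rewrite mulf_eq0 !subr_eq0.
  by case/orP => /eqP ->; [left|right].
apply/eqP; rewrite eq_sym -subr_eq0; apply/eqP; apply: (mulfI d0).
by rewrite E mulr0; case: h => ->; rewrite subrr ?mul0r ?mulr0.
Qed.

Lemma enorm2 (z : 'rV[R]_2) : enorm z = Num.sqrt (z 0 0 ^+ 2 + z 0 1 ^+ 2).
Proof.
rewrite /enorm /dotv !big_ord_recr big_ord0 /= add0r !expr2.
by congr (Num.sqrt (z _ _ * z _ _ + z _ _ * z _ _)); exact: val_inj.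
Qed.

Lemma sqrt_itv (d : R) : 0 <= d -> (a <= Num.sqrt d <= b) = (a ^+ 2 <= d <= b ^+ 2).
Proof.
move=> d0; have b0 : 0 < b by exact: lt_trans ab.
by rewrite -{3 4}(sqr_sqrtr d0) !ler_pXn2r ?nnegrE ?sqrtr_ge0 ?(ltW a0) ?(ltW b0).
Qed.

(** The x-part of the graph map is the identity, so that it is an injective
    immersion. *)
Lemma annulus_quadric : annulus (quadric (a * b) `&` @B4 R).
Proof.
have b0 : 0 < b by exact: lt_trans ab.
have c0 : a * b != 0 by rewrite lt0r_neq0// mulr_gt0.
have sq (z : 'rV[R]_2) : 0 <= z 0 0 ^+ 2 + z 0 1 ^+ 2 by rewrite addr_ge0 ?sqr_ge0.
exists a, b, punctured_plane, (catenoid_graph (a * b)); split=> /=.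
- by rewrite a0.
- split; first exact: punctured_plane_open.
  move=> z /=; rewrite enorm2 sqrt_itv// /punctured_plane /= => /andP[h _].
  by apply: lt_le_trans h; rewrite exprn_gt0.
- split; first exact: catenoid_graph_smooth.
  have dG u : punctured_plane u -> differentiable (catenoid_graph (a * b)) u.
    by have [d _] := catenoid_graph_smooth (a * b) 1%N; exact: d.
  apply: immersion_ker => // u h Pu Dh.
  have [e1 e2 _ _] := is_derive_coords _ _ h (diff_derivable (dG u Pu)).
  have h0 : h 0 0 = 0.
    have e : is_derive u h (fun z => x1 (catenoid_graph (a * b) z)) (h 0 0).
      rewrite (_ : (fun z => _) = fun z : 'rV[R]_2 => z 0 0);
        first exact: is_derive_coord.
      by apply/funext => z; have [] := catenoid_graphE (a * b) z.
    by rewrite -(@derive_val _ _ _ _ _ _ _ e) (@derive_val _ _ _ _ _ _ _ e1) Dh /x1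
      mxE.
  have h1 : h 0 1 = 0.
    have e : is_derive u h (fun z => x2 (catenoid_graph (a * b) z)) (h 0 1).
      rewrite (_ : (fun z => _) = fun z : 'rV[R]_2 => z 0 1);
        first exact: is_derive_coord.
      by apply/funext => z; have [] := catenoid_graphE (a * b) z.
    by rewrite -(@derive_val _ _ _ _ _ _ _ e) (@derive_val _ _ _ _ _ _ _ e2) Dh /x2
      mxE.
  by rewrite (rV2_delta h) h0 h1 !scale0r addr0.
- move=> z z' _ _ zz'; have [h1 h2 _ _] := catenoid_graphE (a * b) z.
  have [h1' h2' _ _] := catenoid_graphE (a * b) z'.
  by rewrite (rV2_delta z) (rV2_delta z') -h1 -h2 -h1' -h2' zz'.
- apply/seteqP; split => [_ [z /= Az <-]|p [qp Bp]].
    have Pz : punctured_plane z.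
      move: Az; rewrite enorm2 sqrt_itv// /punctured_plane /= => /andP[h _].
      by apply: lt_le_trans h; rewrite exprn_gt0.
    have qz := catenoid_graph_quadric (a * b) z Pz; split=> //.
    rewrite /B4 /= enorm_le1 (quadric_B4P _ qz).
    have [-> -> _ _] := catenoid_graphE (a * b) z.
    by rewrite -sqrt_itv// -enorm2.
  exists (vec2 (x1 p) (x2 p)); last exact: catenoid_graphK.
  rewrite /= enorm2 !vec2E sqrt_itv ?addr_ge0 ?sqr_ge0// -quadric_B4P//.
  by move: Bp; rewrite /B4 /= enorm_le1.
Qed.

End Annulus.

(** * Rational charts adapted to the boundary circles *)

Section PolarChart.
Context {R : realType} {a b s k q1 q2 : R}.
Hypotheses (a0 : 0 < a) (ab : a < b) (ab1 : a ^+ 2 + b ^+ 2 = 1).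
Hypothesis sk : (s = -1 /\ k = b) \/ (s = 1 /\ k = a).
Hypothesis q12 : q1 ^+ 2 + q2 ^+ 2 = 1.
Implicit Types u h : 'rV[R]_2.

(** (circ1 w, circ2 w) is the point q (1 + i w)^2 / (1 + w^2) of the unit circle,
    where q = q1 + i q2: the stereographic parameter of the circle without - q,
    which keeps the charts rational. *)
Definition circ1 (w : R) := (q1 * (1 - w ^+ 2) - q2 * (2 * w)) / (1 + w ^+ 2).
Definition circ2 (w : R) := (q2 * (1 - w ^+ 2) + q1 * (2 * w)) / (1 + w ^+ 2).

Definition radius u : R := k + s * u 0 0.

(** A collar of the boundary circle of radius k: s = 1 for the inner circle
    (k = a) and s = -1 for the outer circle (k = b), so that the first coordinate
    is the distance to that circle in the x-plane. *)
Definition polar_chart u : 'rV[R]_4 :=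
  vec4 (radius u * circ1 (u 0 1)) (radius u * circ2 (u 0 1))
       (a * b / radius u * circ1 (u 0 1)) (a * b / radius u * circ2 (u 0 1)).

Definition polar_dom : set 'rV[R]_2 := [set u | - a < u 0 0 < b - a].

Definition polar_nbhs : set 'rV[R]_4 :=
  [set p | s * (Num.sqrt (x1 p ^+ 2 + x2 p ^+ 2) - k) < b - a /\
           0 < Num.sqrt (x1 p ^+ 2 + x2 p ^+ 2) + (q1 * x1 p + q2 * x2 p)].

Definition polar_inv (p : 'rV[R]_4) : 'rV[R]_2 :=
  vec2 (s * (Num.sqrt (x1 p ^+ 2 + x2 p ^+ 2) - k))
    ((q1 * x2 p - q2 * x1 p) /
     (Num.sqrt (x1 p ^+ 2 + x2 p ^+ 2) + (q1 * x1 p + q2 * x2 p))).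

Lemma add1sq_gt0 (w : R) : 0 < 1 + w ^+ 2. Proof. by rewrite ltr_wpDr ?sqr_ge0. Qed.

Lemma circ_norm w : circ1 w ^+ 2 + circ2 w ^+ 2 = 1.
Proof.
have w0 := lt0r_neq0 (add1sq_gt0 w).
transitivity (q1 ^+ 2 + q2 ^+ 2); last by [].
by rewrite /circ1 /circ2; field.
Qed.

Lemma circ_dot w : q1 * circ1 w + q2 * circ2 w = (1 - w ^+ 2) / (1 + w ^+ 2).
Proof.
have w0 := lt0r_neq0 (add1sq_gt0 w).
transitivity ((q1 ^+ 2 + q2 ^+ 2) * ((1 - w ^+ 2) / (1 + w ^+ 2))).
  by rewrite /circ1 /circ2; field.
by rewrite q12 mul1r.
Qed.

Lemma circ_det w : q1 * circ2 w - q2 * circ1 w = 2 * w / (1 + w ^+ 2).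
Proof.
have w0 := lt0r_neq0 (add1sq_gt0 w).
transitivity ((q1 ^+ 2 + q2 ^+ 2) * (2 * w / (1 + w ^+ 2))).
  by rewrite /circ1 /circ2; field.
by rewrite q12 mul1r.
Qed.

Lemma radius_gt0 u : polar_dom u -> 0 < radius u.
Proof.
rewrite /polar_dom /radius /=; move: (u 0 0) (a0) (ab) => x a0' ab' /andP[h1 h2].
by case: sk => -[-> ->]; lra.
Qed.

Lemma radius_itv u : polar_dom u -> half_plane u -> a <= radius u <= b.
Proof.
rewrite /polar_dom /radius /half_plane /=.
move: (u 0 0) (a0) (ab) => x a0' ab' /andP[h1 h2] h3.
by apply/andP; case: sk => -[-> ->]; split; lra.
Qed.

Lemma polar_chartE u : [/\ x1 (polar_chart u) = radius u * circ1 (u 0 1),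
  x2 (polar_chart u) = radius u * circ2 (u 0 1),
  y1 (polar_chart u) = a * b / radius u * circ1 (u 0 1) &
  y2 (polar_chart u) = a * b / radius u * circ2 (u 0 1)].
Proof. exact: vec4E. Qed.

Lemma polar_chart_sqnorm u :
  x1 (polar_chart u) ^+ 2 + x2 (polar_chart u) ^+ 2 = radius u ^+ 2.
Proof.
have [-> -> _ _] := polar_chartE u.
transitivity (radius u ^+ 2 * (circ1 (u 0 1) ^+ 2 + circ2 (u 0 1) ^+ 2)); first ring.
by rewrite circ_norm mulr1.
Qed.

(** The half-angle formula: the parameter w of a point z of the circle is
    Im (z conj q) / (1 + Re (z conj q)). *)
Lemma polar_chart_slope u :
  u 0 1 * (radius u + (q1 * x1 (polar_chart u) + q2 * x2 (polar_chart u))) =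
  q1 * x2 (polar_chart u) - q2 * x1 (polar_chart u).
Proof.
have [-> -> _ _] := polar_chartE u.
have w0 := lt0r_neq0 (add1sq_gt0 (u 0 1)).
transitivity (radius u * (q1 * circ2 (u 0 1) - q2 * circ1 (u 0 1))); last by ring.
transitivity (u 0 1 * (radius u * (1 + (q1 * circ1 (u 0 1) +
  q2 * circ2 (u 0 1))))); first by ring.
by rewrite circ_det circ_dot; field.
Qed.

Lemma polar_chart_den u : polar_dom u ->
  0 < radius u + (q1 * x1 (polar_chart u) + q2 * x2 (polar_chart u)).
Proof.
move=> Du; have r0 := radius_gt0 _ Du; have [-> -> _ _] := polar_chartE u.
have w0 := add1sq_gt0 (u 0 1).
have -> : radius u + (q1 * (radius u * circ1 (u 0 1)) +
  q2 * (radius u * circ2 (u 0 1)))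
  = radius u * (1 + (q1 * circ1 (u 0 1) + q2 * circ2 (u 0 1))) by ring.
rewrite circ_dot; have -> : 1 + (1 - u 0 1 ^+ 2) / (1 + u 0 1 ^+ 2) = 2 / (1 +
  u 0 1 ^+ 2).
  by field; exact: lt0r_neq0.
by rewrite mulr_gt0// divr_gt0.
Qed.

Lemma polar_chart_quadric u : polar_dom u -> quadric (a * b) (polar_chart u).
Proof.
move=> Du; have r0 := lt0r_neq0 (radius_gt0 _ Du); apply/quadricP.
have [-> -> -> ->] := polar_chartE u; split; last by ring.
transitivity (a * b * (circ1 (u 0 1) ^+ 2 + circ2 (u 0 1) ^+ 2)); first by field.
by rewrite circ_norm mulr1.
Qed.

Lemma polar_invK u : polar_dom u -> polar_inv (polar_chart u) = u.
Proof.
move=> Du; have r0 := radius_gt0 _ Du; have d0 := lt0r_neq0 (polar_chart_den _ Du).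
rewrite /polar_inv polar_chart_sqnorm sqrtr_sqr (gtr0_norm r0).
rewrite [LHS]rV2_delta [RHS]rV2_delta !vec2E -polar_chart_slope mulfK//.
congr (_ *: _ + _); rewrite /radius; by case: sk => -[-> ->]; ring.
Qed.

Lemma polar_chartK p : quadric (a * b) p -> polar_nbhs p ->
  polar_chart (polar_inv p) = p.
Proof.
move=> qp [_ rA]; have c0 : a * b != 0.
  by rewrite lt0r_neq0// mulr_gt0//; exact: lt_trans ab.
have d0 := quadric_x_neq0 _ _ c0 qp.
have [e1 e2] := quadric_y _ _ c0 qp.
set d := x1 p ^+ 2 + x2 p ^+ 2 in d0 e1 e2 rA.
set r := Num.sqrt d in rA; have r0 : 0 < r by rewrite sqrtr_gt0.
have r2 : r ^+ 2 = d by rewrite sqr_sqrtr// ltW.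
have rE : radius (polar_inv p) = r.
  by rewrite /radius /polar_inv vec2E -/d -/r; case: sk => -[-> ->]; ring.
have rn0 := lt0r_neq0 r0; have rAn0 := lt0r_neq0 rA.
set A := q1 * x1 p + q2 * x2 p in rA rAn0.
pose B := q1 * x2 p - q2 * x1 p.
have AB : A ^+ 2 + B ^+ 2 = r ^+ 2.
  by rewrite r2 -[RHS]mul1r -q12 /A /B /d; ring.
have wE : polar_inv p 0 1 = B / (r + A) by rewrite /polar_inv vec2E.
have opwE : 1 + (B / (r + A)) ^+ 2 = 2 * r / (r + A).
  transitivity (((r + A) ^+ 2 + B ^+ 2) / (r + A) ^+ 2); first by field.
  rewrite (_ : _ + _ = 2 * r * (r + A)); first by field.
  transitivity (r ^+ 2 + 2 * r * A + (A ^+ 2 + B ^+ 2)); first ring.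
  by rewrite AB; ring.
have omwE : 1 - (B / (r + A)) ^+ 2 = 2 * A / (r + A).
  transitivity (((r + A) ^+ 2 - B ^+ 2) / (r + A) ^+ 2); first by field.
  rewrite (_ : _ - _ = 2 * A * (r + A)); first by field.
  transitivity (r ^+ 2 + 2 * r * A + 2 * A ^+ 2 - (A ^+ 2 + B ^+ 2)); first ring.
  by rewrite AB; ring.
have x1E : q1 * A - q2 * B = x1 p.
  by rewrite -[RHS]mul1r -q12 /A /B; ring.
have x2E : q2 * A + q1 * B = x2 p.
  by rewrite -[RHS]mul1r -q12 /A /B; ring.
have c1E : circ1 (polar_inv p 0 1) = x1 p / r.
  by rewrite /circ1 wE opwE omwE -x1E; field; rewrite rn0 rAn0.
have c2E : circ2 (polar_inv p 0 1) = x2 p / r.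
  by rewrite /circ2 wE opwE omwE -x2E; field; rewrite rn0 rAn0.
have [h1 h2 h3 h4] := polar_chartE (polar_inv p).
by apply: eq_vec4; rewrite ?h1 ?h2 ?h3 ?h4 rE ?c1E ?c2E ?e1 ?e2 -?r2; field.
Qed.

Lemma polar_dom_open : open polar_dom.
Proof.
rewrite (_ : polar_dom = (fun u => u 0 0 : R) @^-1` [set x | - a < x] `&`
   (fun u => u 0 0 : R) @^-1` [set x | x < b - a]); last first.
  by apply/seteqP; split => u /=; [move=> /andP|move=> h; apply/andP].
by apply: openI; apply: open_comp => [u _|];
  [exact: coord_continuous|exact: open_gt|exact: coord_continuous|exact: open_lt].
Qed.

Lemma polar_smooth : smooth_on polar_dom polar_chart.
Proof.
move=> n; have oD := polar_dom_open.
have C0 := @Ck_on_coord R 1 2 polar_dom n 0 0 oD.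
have C1 := @Ck_on_coord R 1 2 polar_dom n 0 1 oD.
have Cc w : Ck_on n polar_dom (fun=> w : R) by exact: Ck_on_cst.
have mulC (f g : 'rV[R]_2 -> R) : Ck_on n polar_dom f -> Ck_on n polar_dom g ->
   Ck_on n polar_dom (fun u => f u * g u : R) by exact: Ck_on_mul.
have addC (f g : 'rV[R]_2 -> R) : Ck_on n polar_dom f -> Ck_on n polar_dom g ->
   Ck_on n polar_dom (fun u => f u + g u : R) by exact: Ck_on_add.
have Cw : Ck_on n polar_dom (fun u : 'rV[R]_2 => (1 + u 0 1 ^+ 2)^-1).
  apply: Ck_on_inv => // [u _|]; first exact/lt0r_neq0/add1sq_gt0.
  by apply: addC => //; exact: mulC.
have Cm : Ck_on n polar_dom (fun u : 'rV[R]_2 => 1 - u 0 1 ^+ 2).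
  apply: (Ck_on_ext oD _ _ (fun u : 'rV[R]_2 => 1 + (-1) * (u 0 1 * u 0 1))).
    by move=> u _; rewrite mulN1r expr2.
  by apply: (addC (fun=> 1)) => //; apply: (mulC (fun=> -1)) => //; exact: mulC.
have C2 : Ck_on n polar_dom (fun u : 'rV[R]_2 => 2 * u 0 1) by exact: mulC.
have Ce1 : Ck_on n polar_dom (fun u => circ1 (u 0 1)).
  apply: (Ck_on_ext oD _ _ (fun u : 'rV[R]_2 =>
    (q1 * (1 - u 0 1 ^+ 2) + (- q2) * (2 * u 0 1)) * (1 + u 0 1 ^+ 2)^-1)).
    by move=> u _; rewrite /circ1 mulNr.
  apply: (mulC (fun u => q1 * (1 - u 0 1 ^+ 2) + (- q2) * (2 * u 0 1))) => //.
  by apply: addC; [exact: (mulC (fun=> q1))|exact: (mulC (fun=> - q2))].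
have Ce2 : Ck_on n polar_dom (fun u => circ2 (u 0 1)).
  apply: (mulC (fun u => q2 * (1 - u 0 1 ^+ 2) + q1 * (2 * u 0 1))) => //.
  by apply: addC; [exact: (mulC (fun=> q2))|exact: (mulC (fun=> q1))].
have Cr : Ck_on n polar_dom radius.
  by apply: (addC (fun=> k)) => //; exact: (mulC (fun=> s)).
have Cri : Ck_on n polar_dom (fun u => a * b / radius u).
  apply: (mulC (fun=> a * b)) => //; apply: Ck_on_inv => // u Du.
  by apply: lt0r_neq0; exact: radius_gt0.
by apply: Ck_on_vec4 => //; exact: mulC.
Qed.

Lemma polar_diff u : polar_dom u -> differentiable polar_chart u.
Proof. by move=> Du; have [d _] := polar_smooth 1%N; exact: d. Qed.

Lemma is_derive_radius u h : is_derive u h radius (s * h 0 0).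
Proof.
have d := is_deriveD (is_derive_cst k u h) (is_deriveZ s (is_derive_coord u h 0 0)).
by apply: is_derive_eq d _; rewrite add0r.
Qed.

(** Differentiating |x|^2 = radius^2 recovers the first coordinate of h, and then
    polar_chart_slope recovers the second. *)
Lemma polar_immersion : immersion_on polar_dom polar_chart.
Proof.
apply: immersion_ker => [u|u h Du Dh]; first exact: polar_diff.
have r0 := radius_gt0 _ Du.
have [] := is_derive_coords _ _ h (diff_derivable (polar_diff u Du)).
rewrite Dh /x1 /x2 !mxE => e1 e2 _ _.
have dr := is_derive_radius u h.
have h0 : h 0 0 = 0.
  have f1 := is_deriveD (is_deriveM e1 e1) (is_deriveM e2 e2).
  have f2 := is_deriveM dr dr.
  have : radius u *: (s * h 0 0) + radius u *: (s * h 0 0) = 0.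
    rewrite -(@derive_val _ _ _ _ _ _ _ f2) (_ : radius * radius =
     (fun z => x1 (polar_chart z) * x1 (polar_chart z) +
               x2 (polar_chart z) * x2 (polar_chart z))); last first.
      by apply/funext => z; rewrite -!expr2 polar_chart_sqnorm.
    by rewrite (@derive_val _ _ _ _ _ _ _ f1) !scaler0 !addr0.
  rewrite /GRing.scale /= -mulr2n => /eqP; rewrite mulrn_eq0 /=.
  rewrite !mulf_eq0 (negbTE (lt0r_neq0 r0)) /=.
  by case: sk => -[-> _]; rewrite ?oppr_eq0 oner_eq0 /= => /eqP.
have h1 : h 0 1 = 0.
  have dA := is_deriveD dr (is_deriveD (is_deriveZ q1 e1) (is_deriveZ q2 e2)).
  have f1 := is_deriveM (is_derive_coord u h 0 1) dA.
  have f2 := is_deriveB (is_deriveZ q1 e2) (is_deriveZ q2 e1).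
  have : 'D_h (fun z : 'rV[R]_2 =>
    z 0 1 * (radius z + (q1 * x1 (polar_chart z) + q2 * x2 (polar_chart z)))) u =
         'D_h (fun z : 'rV[R]_2 => q1 * x2 (polar_chart z) - q2 *
           x1 (polar_chart z)) u.
    by congr ('D_h _ u); apply/funext => z; exact: polar_chart_slope.
  rewrite (@derive_val _ _ _ _ _ _ _ f1) (@derive_val _ _ _ _ _ _ _ f2).
  rewrite h0 /GRing.scale /= !mulr0 !addr0 mulr0 add0r subrr => /eqP.
  rewrite mulf_eq0 => /orP[|/eqP//].
  by rewrite (negbTE (lt0r_neq0 (polar_chart_den _ Du))).
by rewrite (rV2_delta h) h0 h1 !scale0r addr0.
Qed.

Let S := quadric (a * b) `&` @B4 R.
Let X := polar_chart.
Let U := polar_dom.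
Let N := polar_nbhs.
Let Y := polar_inv.

Let rho (p : 'rV[R]_4) : R := Num.sqrt (x1 p ^+ 2 + x2 p ^+ 2).

Lemma Ck0_rho : Ck_on 0 setT rho.
Proof.
have Cx1 : Ck_on 0 setT (@x1 R) by move=> p _; exact: coord_continuous.
have Cx2 : Ck_on 0 setT (@x2 R) by move=> p _; exact: coord_continuous.
have C : Ck_on 0 setT (fun p : 'rV[R]_4 => x1 p ^+ 2 + x2 p ^+ 2).
  by apply: (Ck_on_add openT); exact: (Ck_on_mul openT).
by move=> p _; apply: continuous_comp; [exact: C|exact: sqrt_continuous].
Qed.

Lemma Ck0_dist : Ck_on 0 setT (fun p => s * (rho p - k)).
Proof.
apply: (Ck_on_mul openT); first exact: (Ck_on_cst openT).
by apply: (Ck_on_add openT); [exact: Ck0_rho|exact: (Ck_on_cst openT)].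
Qed.

Lemma Ck0_den : Ck_on 0 setT (fun p => rho p + (q1 * x1 p + q2 * x2 p)).
Proof.
have Cx1 : Ck_on 0 setT (@x1 R) by move=> p _; exact: coord_continuous.
have Cx2 : Ck_on 0 setT (@x2 R) by move=> p _; exact: coord_continuous.
have Cc w : Ck_on 0 setT (fun=> w : R) by exact: (Ck_on_cst openT).
apply: (Ck_on_add openT); first exact: Ck0_rho.
by apply: (Ck_on_add openT); apply: (Ck_on_mul openT).
Qed.

Lemma polar_nbhs_open : open N.
Proof.
rewrite (_ : N = (fun p => s * (rho p - k)) @^-1` [set x | x < b - a] `&`
  (fun p => rho p + (q1 * x1 p + q2 * x2 p)) @^-1` [set x | 0 < x])//.
apply: openI; apply: open_comp => [p _|].
- exact: Ck0_dist.
- exact: open_lt.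
- exact: Ck0_den.
- exact: open_gt.
Qed.

Lemma polar_inv_continuous p : N p -> {for p, continuous Y}.
Proof.
move: p; have oN := polar_nbhs_open.
have sub (f : 'rV[R]_4 -> R) : Ck_on 0 setT f -> Ck_on 0 N f.
  by move=> Cf p _; exact: Cf.
have Cx1 : Ck_on 0 N (@x1 R) by move=> p _; exact: coord_continuous.
have Cx2 : Ck_on 0 N (@x2 R) by move=> p _; exact: coord_continuous.
have Cc w : Ck_on 0 N (fun=> w : R) by exact: (Ck_on_cst oN).
have Cn : Ck_on 0 N (fun p => q1 * x2 p - q2 * x1 p).
  apply: (Ck_on_ext oN _ _ (fun p => q1 * x2 p + (- q2) * x1 p)).
    by move=> p _; rewrite mulNr.
  by apply: (Ck_on_add oN); apply: (Ck_on_mul oN).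
have Cq : Ck_on 0 N (fun p =>
  (q1 * x2 p - q2 * x1 p) / (rho p + (q1 * x1 p + q2 * x2 p))).
  apply: (Ck_on_mul oN) => //; apply: (Ck_on_inv oN); last exact/sub/Ck0_den.
  by move=> p [_ /lt0r_neq0].
have Cd := sub _ Ck0_dist.
apply: (Ck_on_row oN 2 0 (fun j p => [:: s * (rho p - k);
  (q1 * x2 p - q2 * x1 p) / (rho p + (q1 * x1 p + q2 * x2 p))]`_j)).
by move=> -[[|[|//]] j].
Qed.

Lemma polar_chart_mem u : U u -> half_plane u -> (S `&` N) (X u).
Proof.
move=> Uu Hu; have qX := polar_chart_quadric _ Uu.
have r0 := radius_gt0 _ Uu.
have nE := polar_chart_sqnorm u.
have b0 : 0 < b by exact: lt_trans ab.
split.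
  split=> //; rewrite /B4 /= enorm_le1 (quadric_B4P a0 ab ab1 _ qX) nE.
  have /andP[h1 h2] := radius_itv _ Uu Hu.
  by rewrite !ler_pXn2r ?nnegrE ?(ltW a0) ?(ltW b0) ?(ltW r0)// h1 h2.
rewrite /N /polar_nbhs /= nE sqrtr_sqr (gtr0_norm r0); split.
  move: Uu => /andP[_ h]; rewrite /radius addrC addKr mulrA.
  by case: sk => -[-> _]; rewrite ?mulrNN mul1r ?mul1r.
exact: (polar_chart_den _ Uu).
Qed.

Lemma polar_inv_mem p : S p -> N p -> U (Y p) /\ half_plane (Y p).
Proof.
move=> [qp]; rewrite /B4 /= enorm_le1 (quadric_B4P a0 ab ab1 _ qp).
rewrite -sqrt_itv// ?addr_ge0 ?sqr_ge0// -/(rho p) => /andP[ra rb] [rN _].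
rewrite /U /polar_dom /half_plane /= /Y /polar_inv vec2E -/(rho p) in rN *.
split; first apply/andP; move: (a0) (ab) rN ra rb; move: (rho p) => r a0' ab';
  by case: sk => -[-> ->] rN ra rb; [lra|lra] || split; lra.
Qed.

Lemma polar_chart_image : X @` (U `&` @half_plane R) = S `&` N.
Proof.
apply/seteqP; split => [_ [u [Uu Hu] <-]|p [Sp Np]]; first exact: polar_chart_mem.
exists (Y p); first exact: polar_inv_mem.
by apply: polar_chartK => //; case: Sp.
Qed.

Lemma polar_chartP : chart S X U.
Proof.
split.
- exact: polar_dom_open.
- exact: polar_smooth.
- exact: polar_immersion.
- by exists N; [exact: polar_nbhs_open|exact: polar_chart_image].
- exists Y; last by move=> u [Uu _]; exact: polar_invK.
  apply: continuous_in_subspaceT => p /set_mem.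
  by rewrite polar_chart_image => -[_]; exact: polar_inv_continuous.
Qed.

Lemma polar_chart_at p : S p -> N p -> chart_at S X U (Y p) p.
Proof.
move=> Sp Np; have [UY HY] := polar_inv_mem _ Sp Np; split=> //.
  exact: polar_chartP.
by apply: polar_chartK => //; case: Sp.
Qed.

(** (x, - y): complex conjugation of C^2, since the complex coordinates are
    x1 + i y1 and x2 + i y2. *)
Definition conj4 (p : 'rV[R]_4) := vec4 (x1 p) (x2 p) (- y1 p) (- y2 p).

(** Along the ray the circle parameter is constant, so x is proportional to
    radius and y to its inverse, and radius u = k. *)
Lemma polar_chart_normal_derive u : U u -> u 0 0 = 0 ->
  'D_(vec2 (- k) 0) X u = (- s) *: conj4 (X u).
Proof.
move=> Uu u0; set h := vec2 (- k) 0.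
have [d1 d2 d3 d4] := is_derive_coords _ _ h (diff_derivable (polar_diff u Uu)).
have dr := is_derive_radius u h.
have rE : radius u = k by rewrite /radius u0 mulr0 addr0.
have k0 : k != 0 by rewrite -rE; exact: lt0r_neq0 (radius_gt0 _ Uu).
have h0 : h 0 0 = - k by rewrite vec2E.
have ray (t : R) : (t *: h + u) 0 1 = u 0 1 by rewrite !mxE /= mulr0 add0r.
have Ur : \forall t \near 0^'+, U (t *: h + u).
  by apply: cvg_within; apply: near_ray; apply: open_nbhs_nbhs; split=> //;
    exact: polar_dom_open.
have xD (f : 'rV[R]_2 -> R) (e df : R) : is_derive u h f df ->
    (forall z : 'rV[R]_2, z 0 1 = u 0 1 -> f z = radius z * e) -> df = (- s) * f u.
  move=> fd fE.
  have d := is_deriveB fd (is_deriveZ e dr).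
  have : df - e *: (s * h 0 0) = 0.
    rewrite -(@derive_val _ _ _ _ _ _ _ d); apply: (derive_cst_ray _ u h 0) => //.
      by rewrite -[LHS]/(f u - e * radius u) fE// mulrC subrr.
    near=> t; rewrite -[LHS]/(f (t *: h + u) - e * radius (t *: h + u)).
    by rewrite fE// mulrC subrr.
  by move=> /eqP; rewrite subr_eq0 => /eqP ->; rewrite h0 fE// rE /GRing.scale /=;
    ring.
(* Differentiate radius * f, which is constant along the ray. *)
have yD (f : 'rV[R]_2 -> R) (e df : R) : is_derive u h f df ->
    (forall z : 'rV[R]_2, z 0 1 = u 0 1 -> f z = a * b / radius z * e) ->
      df = s * f u.
  move=> fd fE.
  have d := is_deriveM dr fd.
  have : radius u *: df + f u *: (s * h 0 0) = 0.
    rewrite -(@derive_val _ _ _ _ _ _ _ d);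
      apply: (derive_cst_ray _ u h (a * b * e)) => //.
      rewrite -[LHS]/(radius u * f u) fE// rE; field; exact: k0.
    near=> t; rewrite -[LHS]/(radius (t *: h + u) * f (t *: h + u)) fE//.
    field; apply: lt0r_neq0; apply: radius_gt0; near: t; exact: Ur.
  rewrite h0 rE /GRing.scale /= => e0; apply: (mulfI k0).
  by rewrite -[LHS]subr0 -e0; ring.
have E1 (z : 'rV[R]_2) : z 0 1 = u 0 1 -> x1 (X z) = radius z * circ1 (u 0 1).
  by move=> <-; have [] := polar_chartE z.
have E2 (z : 'rV[R]_2) : z 0 1 = u 0 1 -> x2 (X z) = radius z * circ2 (u 0 1).
  by move=> <-; have [] := polar_chartE z.
have E3 (z : 'rV[R]_2) : z 0 1 = u 0 1 -> y1 (X z) = a * b / radius z * circ1 (u 0 1).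
  by move=> <-; have [] := polar_chartE z.
have E4 (z : 'rV[R]_2) : z 0 1 = u 0 1 -> y2 (X z) = a * b / radius z * circ2 (u 0 1).
  by move=> <-; have [] := polar_chartE z.
have [f1 f2 f3 f4] := vec4E (x1 (X u)) (x2 (X u)) (- y1 (X u)) (- y2 (X u)).
have [g1 g2 g3 g4] := coordZ (- s) (conj4 (X u)).
apply: eq_vec4; rewrite ?g1 ?g2 ?g3 ?g4 ?f1 ?f2 ?f3 ?f4 ?mulrNN.
- exact: xD d1 E1.
- exact: xD d2 E2.
- exact: yD d3 E3.
- exact: yD d4 E4.
Unshelve. all: by end_near. Qed.

End PolarChart.

(** * Boundary, conormal and contact angle *)

Section TruncatedQuadric.
Context {R : realType} {a b : R}.
Hypotheses (a0 : 0 < a) (ab : a < b) (ab1 : a ^+ 2 + b ^+ 2 = 1).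
Let S := quadric (a * b) `&` @B4 R.
Let b0 : 0 < b. Proof. exact: lt_trans ab. Qed.
Let c0 : a * b != 0. Proof. by rewrite lt0r_neq0// mulr_gt0. Qed.

Lemma prod_radii_lt : 0 < a * b < 1 / 2.
Proof.
rewrite mulr_gt0//=; have : 0 < (b - a) ^+ 2 by rewrite exprn_gt0// subr_gt0.
rewrite (_ : (b - a) ^+ 2 = a ^+ 2 + b ^+ 2 - 2 * (a * b)); last by ring.
by rewrite ab1; lra.
Qed.

Definition collar (s k : R) := (s = -1 /\ k = b) \/ (s = 1 /\ k = a).

(** The circle parameter is centered at the argument of x(p), away from the
    point omitted by the stereographic parameter. *)
Lemma chart_near_collar s k p : collar s k -> S p ->
  s * (Num.sqrt (x1 p ^+ 2 + x2 p ^+ 2) - k) < b - a ->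
  exists q1 q2, let X := @polar_chart R a b s k q1 q2 in
    let u := @polar_inv R s k q1 q2 p in
    [/\ chart_at S X (@polar_dom R a b) u p,
        u 0 0 = s * (Num.sqrt (x1 p ^+ 2 + x2 p ^+ 2) - k) &
        u 0 0 = 0 -> 'D_(vec2 (- k) 0) X u = (- s) *: conj4 p].
Proof.
move=> sk Sp; have [qp _] := Sp.
have d0 := quadric_x_neq0 _ _ c0 qp; set d := x1 p ^+ 2 + x2 p ^+ 2 in d0 *.
set r := Num.sqrt d => rk; have r0 : 0 < r by rewrite sqrtr_gt0.
have r2 : r ^+ 2 = d by rewrite sqr_sqrtr// ltW.
have rn0 := lt0r_neq0 r0.
exists (x1 p / r), (x2 p / r) => X u.
have q12 : (x1 p / r) ^+ 2 + (x2 p / r) ^+ 2 = 1.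
  by rewrite !expr_div_n r2 -mulrDl -/d divff// lt0r_neq0.
have Np : @polar_nbhs R a b s k (x1 p / r) (x2 p / r) p.
  split; rewrite -/d -/r//.
  rewrite (_ : x1 p / r * x1 p + x2 p / r * x2 p = r) ?addr_gt0//.
  transitivity (d / r); first by rewrite /d; field.
  by rewrite -r2; field.
have cu : chart_at S X (@polar_dom R a b) u p by exact: polar_chart_at.
split=> // [|u0]; first by rewrite /u /polar_inv vec2E.
have [_ Uu _ Xu] := cu.
by rewrite -Xu; exact: polar_chart_normal_derive.
Qed.

Lemma radius_itvP p : S p -> a <= Num.sqrt (x1 p ^+ 2 + x2 p ^+ 2) <= b.
Proof.
by move=> [qp]; rewrite /B4 /= enorm_le1 (quadric_B4P a0 ab ab1 _ qp)
  -sqrt_itv// addr_ge0 ?sqr_ge0.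
Qed.

Lemma embedded_quadric : embedded_surface S.
Proof.
move=> p Sp; have /andP[ra rb] := radius_itvP _ Sp.
set r := Num.sqrt _ in ra rb.
(* The inner collar covers everything but the outer circle. *)
have [rb'|rb'] := ltP r b.
  have [||q1 [q2 [cp _ _]]] := chart_near_collar 1 a p _ Sp _.
  - by right.
  - by rewrite mul1r ltrD2r.
  by do 3!eexists; exact: cp.
have [||q1 [q2 [cp _ _]]] := chart_near_collar (-1) b p _ Sp _.
- by left.
- rewrite -/r mulN1r opprB ltrD2l ltrN2; exact: lt_le_trans rb'.
by do 3!eexists; exact: cp.
Qed.

Definition bdry_circle (k : R) : set 'rV[R]_4 :=
  [set p | quadric (a * b) p /\ x1 p ^+ 2 + x2 p ^+ 2 = k ^+ 2].

Lemma bdry_circle_dotv s k p : collar s k -> bdry_circle k p -> dotv p p = 1.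
Proof.
move=> sk [qp dk]; apply/(quadric_S3P a0 ab ab1 _ qp); rewrite dk.
by case: sk => -[_ ->]; [right|left].
Qed.

Lemma bdry_circle_chart s k p : collar s k -> bdry_circle k p ->
  exists X U u, [/\ chart_at S X U u p, u 0 0 = 0 &
    'D_(vec2 (- k) 0) X u = (- s) *: conj4 p].
Proof.
move=> sk Cp; have [qp dk] := Cp.
have k0 : 0 < k by case: sk => -[_ ->].
have Sp : S p by split=> //; rewrite /B4 /= enorm_le1 (bdry_circle_dotv _ _ _ sk Cp).
have rk : Num.sqrt (x1 p ^+ 2 + x2 p ^+ 2) = k by rewrite dk sqrtr_sqr gtr0_norm.
have [|q1 [q2 [cp u0 D]]] := chart_near_collar s k p sk Sp _.
  by rewrite rk subrr mulr0 subr_gt0.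
rewrite rk subrr mulr0 in u0.
by do 3!eexists; split; [exact: cp|exact: u0|exact: D].
Qed.

Lemma bdryE : bdry S = bdry_circle a `|` bdry_circle b.
Proof.
apply/seteqP; split => [p bp|p].
  have [X [U [u [[chX Uu Hu Xu] _]]]] := bp.
  have [qp _] : S p by rewrite -Xu; exact: (chart_mem chX).
  have := bdry_quadric_sphere S (a * b) p c0 erefl bp.
  by move=> /(quadric_S3P a0 ab ab1 _ qp)[]; [left|right].
have ca : collar 1 a by right.
have cb : collar (-1) b by left.
by case=> [/(bdry_circle_chart _ _ _ ca)|/(bdry_circle_chart _ _ _ cb)]
  [X [U [u [cp u0 _]]]]; exists X, U, u.
Qed.

Lemma bdry_circle_slope k p : bdry_circle k p ->
  y1 p = a * b / k ^+ 2 * x1 p /\ y2 p = a * b / k ^+ 2 * x2 p.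
Proof. by move=> [qp <-]; exact: quadric_y. Qed.

Lemma outward_conormal_quadric s k p : collar s k -> bdry_circle k p ->
  outward_conormal S p ((- s) *: conj4 p).
Proof.
move=> sk Cp; have k0 : 0 < k by case: sk => -[_ ->].
have [X [U [u [[chX Uu Hu Xu] u0 D]]]] := bdry_circle_chart _ _ _ sk Cp.
have [f1 f2 f3 f4] := vec4E (x1 p) (x2 p) (- y1 p) (- y2 p).
split.
- exists X, U, u, (vec2 (- k) 0); split=> //.
    by rewrite vec2E oppr_lt0.
  by rewrite -D; exact/deriveE/(chart_diff chX).
- apply/enorm_eq1; rewrite -(bdry_circle_dotv _ _ _ sk Cp).
  have [g1 g2 g3 g4] := coordZ (- s) (conj4 p).
  rewrite !dotv4E g1 g2 g3 g4 f1 f2 f3 f4.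
  by case: sk => -[-> _]; ring.
- move=> v /(bdry_tangent_so2_field prod_radii_lt erefl)[t ->].
  have [g1 g2 g3 g4] := coordZ (- s) (conj4 p).
  have [h1 h2 h3 h4] := coordZ t (so2_field p).
  have [e1 e2 e3 e4] := vec4E (- x2 p) (x1 p) (- y2 p) (y1 p).
  by rewrite !dotv4E g1 g2 g3 g4 f1 f2 f3 f4 h1 h2 h3 h4 e1 e2 e3 e4; ring.
Qed.

(** With y = (a b / k^2) x and a^2 + b^2 = 1, the equation
    - s (x, - y) = (b^2 - a^2) p + 2 s a b Jc p holds on the circle, and
    (b^2 - a^2)^2 + (2 a b)^2 = 1. *)
Lemma contact_angle_quadric s k p : collar s k -> bdry_circle k p ->
  contact_angle S p (acos (s * (2 * (a * b)))).
Proof.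
move=> sk Cp; have /andP[c1 c2] := prod_radii_lt.
have k0 : 0 < k by case: sk => -[_ ->].
have kn0 := lt0r_neq0 k0.
have s2 : s ^+ 2 = 1 by case: sk => -[-> _]; ring.
have sc : -1 < s * (2 * (a * b)) < 1.
  move: (c1) (c2); move: (a * b) => c ? ?.
  by case: sk => -[-> _]; apply/andP; split; lra.
have /andP[sc1 sc2] := sc.
split; first by rewrite acos_ge0 ?ltW// acos_ltpi// sc1 ltW.
exists ((- s) *: conj4 p); first exact: outward_conormal_quadric sk Cp.
rewrite acosK; last by rewrite in_itv/= !ltW.
rewrite sin_acos; last by rewrite !ltW.
have -> : Num.sqrt (1 - (s * (2 * (a * b))) ^+ 2) = b ^+ 2 - a ^+ 2.
  rewrite (_ : 1 - _ = (b ^+ 2 - a ^+ 2) ^+ 2); last first.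
    transitivity ((a ^+ 2 + b ^+ 2) ^+ 2 - s ^+ 2 * (2 * (a * b)) ^+ 2).
      by rewrite ab1 expr1n exprMn.
    by rewrite s2; ring.
  by rewrite sqrtr_sqr ger0_norm// subr_ge0 ler_pXn2r ?nnegrE ?(ltW a0) ?(ltW b0)//
    ltW.
have [e1 e2] := bdry_circle_slope _ _ Cp.
have [f1 f2 f3 f4] := vec4E (x1 p) (x2 p) (- y1 p) (- y2 p).
have [g1 g2 g3 g4] := coordZ (- s) (conj4 p).
have [h1 h2 h3 h4] := coord_lin (b ^+ 2 - a ^+ 2) p (s * (2 * (a * b)) *: Jc p).
have [i1 i2 i3 i4] := coordZ (s * (2 * (a * b))) (Jc p).
have [j1 j2 j3 j4] := vec4E (- y1 p) (- y2 p) (x1 p) (x2 p).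
have an0 := lt0r_neq0 a0; have bn0 := lt0r_neq0 b0.
have main (x y : R) : y = a * b / k ^+ 2 * x ->
  (- s) * x = (b ^+ 2 - a ^+ 2) * x + s * (2 * (a * b)) * - y /\
  (- s) * - y = (b ^+ 2 - a ^+ 2) * y + s * (2 * (a * b)) * x.
  move=> ->; have -> : - s = - s * (a ^+ 2 + b ^+ 2) by rewrite ab1 mulr1.
  by case: sk => -[-> ->]; split; field; rewrite ?an0 ?bn0.
have [m1 m3] := main _ _ e1; have [m2 m4] := main _ _ e2.
apply: eq_vec4.
- by rewrite g1 h1 i1 f1 j1.
- by rewrite g2 h2 i2 f2 j2.
- by rewrite g3 h3 i3 f3 j3.
- by rewrite g4 h4 i4 f4 j4.
Qed.

End TruncatedQuadric.

(** * Components of the boundary *)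

Lemma connected_component_setU {T : topologicalType} (A B : set T) x :
  closed A -> closed B -> A `&` B = set0 -> connected A -> A x ->
  connected_component (A `|` B) x = A.
Proof.
move=> cA cB AB ctA Ax; apply/seteqP; split.
  have sAB : separated A B.
    by split; [rewrite -(closure_id A).1|rewrite -(closure_id B).1].
  have [//|CB] := connected_subset sAB (@connected_component_sub _ _ x)
    (@component_connected _ (A `|` B) x).
  have : (A `&` B) x.
    by split=> //; apply: CB; apply: connected_component_refl; left.
  by rewrite AB.
by apply: connected_component_max => // y; left.
Qed.

Section Circles.
Context {R : realType} {a b : R}.
Hypotheses (a0 : 0 < a) (ab : a < b) (ab1 : a ^+ 2 + b ^+ 2 = 1).
Let S := quadric (a * b) `&` @B4 R.
Let circle := @bdry_circle R a b.
Let b0 : 0 < b. Proof. exact: lt_trans ab. Qed.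
Let c0 : a * b != 0. Proof. by rewrite lt0r_neq0// mulr_gt0. Qed.

Lemma bdry_circle_param k : 0 < k -> circle k =
  range (fun phi : R => vec4 (k * cos phi) (k * sin phi)
     (a * b / k * cos phi) (a * b / k * sin phi)).
Proof.
move=> k0; have kn0 := lt0r_neq0 k0.
apply/seteqP; split => [p Cp|_ [phi _ <-]].
  have [e1 e2] := bdry_circle_slope a0 ab _ _ Cp; have [qp dk] := Cp.
  have [|phi [_ cE sE]] := polar_angle (x1 p / k) (x2 p / k).
    by rewrite !expr_div_n -mulrDl dk divff// expf_neq0.
  have [h1 h2 h3 h4] := vec4E (k * cos phi) (k * sin phi)
     (a * b / k * cos phi) (a * b / k * sin phi).
  exists phi => //; apply: eq_vec4; rewrite ?h1 ?h2 ?h3 ?h4 ?cE ?sE ?e1 ?e2; by field.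
have [h1 h2 h3 h4] := vec4E (k * cos phi) (k * sin phi)
     (a * b / k * cos phi) (a * b / k * sin phi).
split; last by rewrite h1 h2 !exprMn -mulrDr cos2Dsin2 mulr1.
apply/quadricP; rewrite h1 h2 h3 h4; split; last by ring.
transitivity (a * b * (cos phi ^+ 2 + sin phi ^+ 2)); first by field.
by rewrite cos2Dsin2 mulr1.
Qed.

Lemma bdry_circle_connected k : 0 < k -> connected (circle k).
Proof.
move=> k0; rewrite bdry_circle_param//; apply: connected_continuous_connected.
  by apply/connected_intervalP => x y _ _ z _.
apply: continuous_subspaceT => phi.
have Cc w : Ck_on 0 setT (fun _ : R => w : R) by exact: (Ck_on_cst openT).
have Cm w (f : R -> R) : continuous f -> Ck_on 0 setT (fun t => w * f t).
  by move=> cf; apply: (Ck_on_mul openT) => // t _; exact: cf.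
suff C : Ck_on 0 setT (fun phi : R => vec4 (k * cos phi) (k * sin phi)
    (a * b / k * cos phi) (a * b / k * sin phi)) by exact: C.
by apply: (Ck_on_vec4 openT); apply: Cm;
  first [exact: continuous_cos|exact: continuous_sin].
Qed.

Lemma bdry_circle_closed k : closed (circle k).
Proof.
have cl (f : 'rV[R]_4 -> R) w : continuous f -> closed [set p | f p = w].
  move=> cf; rewrite (_ : [set p | f p = w] = f @^-1` [set w])//.
  by apply: preimage_closed => [p _|]; [exact: cf|exact: closed_eq].
have did p : differentiable (id : 'rV[R]_4 -> 'rV[R]_4) p by [].
rewrite (_ : circle k = [set p | reB p p = 2 * (a * b)] `&` [set p | imB p p = 0]
  `&` [set p | x1 p ^+ 2 + x2 p ^+ 2 = k ^+ 2])//.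
apply: closedI; first apply: closedI; apply: cl => p.
- by apply: differentiable_continuous; exact: (differentiable_reB id id).
- by apply: differentiable_continuous; exact: (differentiable_imB id id).
- have Cx1 : Ck_on 0 setT (@x1 R) by move=> q _; exact: coord_continuous.
  have Cx2 : Ck_on 0 setT (@x2 R) by move=> q _; exact: coord_continuous.
  suff C : Ck_on 0 setT (fun p : 'rV[R]_4 => x1 p ^+ 2 + x2 p ^+ 2) by exact: C.
  by apply: (Ck_on_add openT); exact: (Ck_on_mul openT).
Qed.

Lemma bdry_circle_disjoint : circle a `&` circle b = set0.
Proof.
apply/seteqP; split => // p [[_ da] [_ db]]; have : a ^+ 2 < b ^+ 2.
  by rewrite ltr_pXn2r ?nnegrE ?(ltW a0) ?(ltW b0).
by rewrite -da db ltxx.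
Qed.

Lemma bdry_component k p : k = a \/ k = b -> circle k p ->
  connected_component (bdry S) p = circle k.
Proof.
move=> kab Cp; rewrite (bdryE a0 ab ab1).
have ca := bdry_circle_closed a; have cb := bdry_circle_closed b.
have dab := bdry_circle_disjoint.
case: kab Cp => -> Cp.
  by apply: connected_component_setU => //; exact: bdry_circle_connected.
rewrite setUC; apply: connected_component_setU => //.
  by rewrite setIC.
exact: bdry_circle_connected.
Qed.

Lemma bdry_circle_nonempty k : 0 < k -> circle k !=set0.
Proof. by move=> k0; rewrite bdry_circle_param//; eexists; exists 0. Qed.

Lemma bdry_components : components (bdry S) = [set circle a; circle b].
Proof.
apply/seteqP; split => [_ [p bp <-]|C].
  have [Cp|Cp] : (circle a `|` circle b) p by rewrite -(bdryE a0 ab ab1).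
    by left; exact: (bdry_component a p (or_introl erefl) Cp).
  by right; exact: (bdry_component b p (or_intror erefl) Cp).
have [p Cp] := bdry_circle_nonempty a a0; have [q Cq] := bdry_circle_nonempty b b0.
case=> ->.
  exists p; first by rewrite (bdryE a0 ab ab1); left.
  by apply: bdry_component => //; left.
exists q; first by rewrite (bdryE a0 ab ab1); right.
by apply: bdry_component => //; right.
Qed.

Lemma bdry_circle_neq : circle a <> circle b.
Proof.
move=> E; have [p Cp] := bdry_circle_nonempty a a0.
have : (circle a `&` circle b) p by split=> //; rewrite -E.
by rewrite bdry_circle_disjoint.
Qed.

(** The plane is { y = m x } with m = a b / k^2; on the sphere
    |x|^2 (1 + m^2) = 1, which gives back |x| = k. *)
Lemma bdry_circle_great s k : @collar R a b s k -> great_circle (circle k).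
Proof.
move=> sk; have k0 : 0 < k by case: sk => -[_ ->].
have kn0 := lt0r_neq0 k0; have an0 := lt0r_neq0 a0; have bn0 := lt0r_neq0 b0.
pose m := a * b / k ^+ 2.
pose W : 'M[R]_(2, 4) := \matrix_(i < 2)
  (if i == 0 then vec4 1 0 m 0 else vec4 0 1 0 m).
have WE (D : 'rV[R]_2) : D *m W = vec4 (D 0 0) (D 0 1) (m * D 0 0) (m * D 0 1).
  apply/rowP => j; rewrite mxE !big_ord_recr big_ord0 /= add0r !mxE /=.
  have -> : widen_ord (leqnSn 1) ord_max = 0 :> 'I_2 by exact: val_inj.
  have -> : ord_max = 1 :> 'I_2 by exact: val_inj.
  by case: j => -[|[|[|[|//]]]] j /=; ring.
exists W; split.
  apply/eqP; change (row_free W); apply/row_freeP.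
  exists (\matrix_(i < 4, j < 2) ((i : nat) == j)%:R).
  apply/row_matrixP => i; rewrite row_mul row1 rowK.
  apply/rowP => j; rewrite !mxE !big_ord_recr big_ord0 /= !mxE /=.
  by case: i => -[|[|//]] i; case: j => -[|[|//]] j /=; rewrite !mxE /=; ring.
apply/seteqP; split => p.
  move=> Cp; split.
    by apply/enorm_eq1; exact: (bdry_circle_dotv a0 ab ab1 _ _ _ sk Cp).
  have [e1 e2] := bdry_circle_slope a0 ab _ _ Cp.
  apply/submxP; exists (vec2 (x1 p) (x2 p)); rewrite WE !vec2E.
  have [h1 h2 h3 h4] := vec4E (x1 p) (x2 p) (m * x1 p) (m * x2 p).
  by apply: eq_vec4; rewrite ?h1 ?h2 ?h3 ?h4.
move=> [/enorm_eq1 pp /submxP[D]]; rewrite WE => pE.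
have [] := vec4E (D 0 0) (D 0 1) (m * D 0 0) (m * D 0 1); rewrite -pE => h1 h2 h3 h4.
rewrite dotv4E h1 h2 h3 h4 in pp.
have dk : D 0 0 ^+ 2 + D 0 1 ^+ 2 = k ^+ 2.
  transitivity (k ^+ 2 * (D 0 0 * D 0 0 + D 0 1 * D 0 1 + m * D 0 0 * (m * D 0 0) +
     m * D 0 1 * (m * D 0 1))); last by rewrite pp mulr1.
  transitivity ((D 0 0 ^+ 2 + D 0 1 ^+ 2) * (a ^+ 2 + b ^+ 2));
    first by rewrite ab1 mulr1.
  by rewrite /m; move: an0 bn0 kn0; case: sk => -[_ ->] an0' bn0' kn0'; field.
split; last by rewrite h1 h2.
apply/quadricP; rewrite h1 h2 h3 h4; split; last by ring.
transitivity (m * (D 0 0 ^+ 2 + D 0 1 ^+ 2)); first by ring.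
by rewrite dk /m; field.
Qed.

End Circles.

(** Both circles have a constant angle, and a connected component of the
    boundary is contained in one of them. *)
Lemma capillary_quadric (R : realType) (a b : R) : 0 < a -> a < b ->
  a ^+ 2 + b ^+ 2 = 1 ->
  legendrian_capillary_boundary (quadric (a * b) `&` @B4 R).
Proof.
move=> a0 ab ab1; split.
  exact: legendrian_boundary_quadric (prod_radii_lt a0 ab ab1) erefl.
have a2b2 : a ^+ 2 < b ^+ 2.
  by rewrite ltr_pXn2r ?nnegrE ?(ltW a0) ?(ltW (lt_trans a0 ab)).
exists (fun p => if x1 p ^+ 2 + x2 p ^+ 2 == b ^+ 2 then acos (-1 * (2 * (a * b)))
  else acos (1 * (2 * (a * b)))); split.
  move=> p; rewrite (bdryE a0 ab ab1) => -[Cp|Cp]; have [_ dp] := Cp; rewrite dp.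
    rewrite lt_eqF//; apply: (contact_angle_quadric a0 ab ab1 1 a p _ Cp).
    by right.
  rewrite eqxx; apply: (contact_angle_quadric a0 ab ab1 (-1) b p _ Cp).
  by left.
move=> p q bp.
have [Cp|Cp] : (@bdry_circle R a b a `|` @bdry_circle R a b b) p.
    by rewrite -(bdryE a0 ab ab1).
  rewrite (bdry_component a0 ab ab1 a p (or_introl erefl) Cp) => -[_ ->].
  by case: Cp => _ ->.
rewrite (bdry_component a0 ab ab1 b p (or_intror erefl) Cp) => -[_ ->].
by case: Cp => _ ->.
Qed.

Theorem proposition2p6 (R : realType) (r0 : R) (hr0 : Num.sqrt 2 < r0) :
  [/\ embedded_surface (truncated_catenoid r0),
      lagrangian (truncated_catenoid r0),
      minimal (truncated_catenoid r0),
      annulus (truncated_catenoid r0)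
    & legendrian_capillary_boundary (truncated_catenoid r0)] /\
  exists C1 C2 : set 'rV[R]_4,
    [/\ C1 <> C2, components (bdry (truncated_catenoid r0)) = [set C1; C2],
        great_circle C1 & great_circle C2].
Proof.
have r00 : 0 < r0 by apply: le_lt_trans hr0; exact: sqrtr_ge0.
have r02 : 2 < r0 ^+ 2.
  rewrite -[X in X < _](@sqr_sqrtr R 2) ?ler0n//.
  by rewrite ltr_pXn2r ?nnegrE ?sqrtr_ge0 ?(ltW r00).
have c01 : 0 < r0 ^- 2 < 1 / 2.
  by rewrite invr_gt0 exprn_gt0//= div1r ltf_pV2 ?posrE ?exprn_gt0.
have [a [b [/andP[a0 ab] abE ab1]]] := radii_exist _ c01.
have c0 : a * b != 0 by rewrite abE lt0r_neq0//; case/andP: c01.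
rewrite truncated_catenoidE// -abE.
have Sc : quadric (a * b) `&` @B4 R `<=` quadric (a * b) by move=> p [].
split; first split.
- exact: embedded_quadric a0 ab ab1.
- exact: lagrangian_quadric c0 Sc.
- exact: minimal_quadric c0 Sc.
- exact: annulus_quadric a0 ab ab1.
- exact: capillary_quadric a0 ab ab1.
exists (@bdry_circle R a b a), (@bdry_circle R a b b); split.
- exact: bdry_circle_neq a0 ab.
- exact: bdry_components a0 ab ab1.
- by apply: (bdry_circle_great a0 ab ab1 1); right.
- by apply: (bdry_circle_great a0 ab ab1 (-1)); left.
Qed.
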